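(* Let $T$ be a singular integral operator defined by $$Tf(x)=\mathrm{p.v.}\int_{\mathbb{R}^n}k(x,y)f(y)\,dy$$ such that (1) for some $c>0$, $k(x,y)$ satisfies $$|k(x,y)-k(x',y)|\le c\,\frac{1}{|x-y|^n}\,\omega\Big(\frac{|x-x'|}{|x-y|}\Big)$$ whenever $x,x'\in Q$ and $y\in(2Q)^c$ for any cube $Q$, where $\omega(t)$ is a nondecreasing function on $(0,\infty)$ such that $$\int_0^1\omega(c_nt)\,\frac{dt}{t}<\infty;$$ and (2) for some $1\le r<\infty$, $T$ is of weak-type $(r,r)$. Then for $0<s\le1/2$, any cube $Q_0$, and $x\in Q_0$, $$M^{\sharp}_{0,s,Q_0}(Tf)(x)\le c\sup_{x\in Q,\,Q\subset Q_0}\ \inf_{y\in Q}M_rf(y),$$ with $c$ independent of $f$, $x$ and $Q_0$. Moreover, if we also have that $T(1)=0$ and $\int_0^1\omega(c_nt)\ln(1/t)\,\frac{dt}{t}<\infty$, then $$M^{\sharp}_{0,s,Q_0}(Tf)(x)\le c\sup_{x\in Q,\,Q\subset Q_0}\ \inf_{y\in Q}M^{\sharp}_rf(y).$$ In particular, if $Q_0=\mathbb{R}^n$, then $M^{\sharp}_{0,s}(Tf)(x)\le c\,M_rf(x)$ and $M^{\sharp}_{0,s}(Tf)(x)\le c\,M^{\sharp}_rf(x)$, respectively.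
   Context: All cubes have sides parallel to the axes; $\lambda Q$ is the cube concentric with $Q$ with sidelength multiplied by $\lambda$. The dimensional constant $c_n$ is such that for every cube $Q$ in $\mathbb{R}^n$, if $x,x'\in Q$ and $y\notin2^mQ$ for some $m\ge1$, then $\frac{|x-x'|}{|x-y|}\le c_n2^{-m}$. $Mf$ is the Hardy-Littlewood maximal function, $M_rf=M(|f|^r)^{1/r}$, and $$M^{\sharp}_rf(x)=\sup_{x\in Q}\inf_c\Big(\frac{1}{|Q|}\int_Q|f(y)-c|^r\,dy\Big)^{1/r}.$$ The local sharp maximal functions are $$M^{\sharp}_{0,s,Q_0}g(x)=\sup_{x\in Q,\,Q\subset Q_0}\ \inf_c\ \inf\{\alpha\ge0:|\{y\in Q:|g(y)-c|>\alpha\}|<s|Q|\}\quad(x\in Q_0),$$ $$M^{\sharp}_{0,s}g(x)=\sup_{x\in Q}\ \inf_c\ \inf\{\alpha\ge0:|\{y\in Q:|g(y)-c|>\alpha\}|<s|Q|\}\quad(x\in\mathbb{R}^n),$$ with suprema over cubes $Q$. $T$ is of weak-type $(r,r)$ if $\lambda^r|\{|Tf|>\lambda\}|\le c\|f\|_{L^r}^r$ for all $\lambda>0$. $T(1)=0$ means that $T$ annihilates constants. *)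

(* Defs.v *)
From HB Require Import structures.
From mathcomp Require Import all_boot all_order all_algebra.
From mathcomp Require Import all_classical all_reals all_analysis.

Set Implicit Arguments.
Unset Strict Implicit.
Unset Printing Implicit Defensive.
Import Order.TTheory GRing.Theory Num.Theory.
Import numFieldNormedType.Exports.

Local Open Scope classical_set_scope.
Local Open Scope ring_scope.

(* The space R^d with d >= 1 is 'rV[R]_n.+1 (so d = n.+1). Its library norm is
   the max norm; the Euclidean distance is [edist] below. *)

Section lebesgue_measure_rV.
Context {R : realType} {n : nat}.
Implicit Types (a b : 'rV[R]_n.+1) (A : set 'rV[R]_n.+1).
Local Open Scope ereal_scope.

Definition box a b : set 'rV[R]_n.+1 :=
  [set x | forall i, (a 0 i < x 0 i <= b 0 i)%R].

Definition box_vol a b : R := (\prod_i Num.max 0 (b 0 i - a 0 i))%R.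

Definition box_cover A : set (nat -> 'rV[R]_n.+1 * 'rV[R]_n.+1) :=
  [set B | A `<=` \bigcup_k box (B k).1 (B k).2].

Definition leb_outer A : \bar R :=
  ereal_inf [set \sum_(k <oo) (box_vol (B k).1 (B k).2)%:E | B in box_cover A].

Lemma box_vol_ge0 a b : (0 <= box_vol a b)%R.
Proof. by apply: prodr_ge0 => i _; rewrite le_max lexx. Qed.

Let vol_ge0 (B : nat -> 'rV[R]_n.+1 * 'rV[R]_n.+1) k :
  0 <= (box_vol (B k).1 (B k).2)%:E.
Proof. by rewrite lee_fin box_vol_ge0. Qed.

Let leb_outer_ge0 A : 0 <= leb_outer A.
Proof.
by apply: le_ereal_inf_tmp => x [B _ <-{x}]; apply: nneseries_ge0 => k _ _.
Qed.

Let leb_outer0 : leb_outer set0 = 0.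
Proof.
apply/eqP; rewrite eq_le leb_outer_ge0 andbT; apply: ereal_inf_lbound.
exists (fun=> (0%R, 0%R)); first by move=> x.
apply: eseries0 => k _ _ /=; congr (_%:E).
by rewrite /box_vol big_ord_recl !mxE subrr maxxx mul0r.
Qed.

Let le_leb_outer : {homo leb_outer : A B / A `<=` B >-> A <= B}.
Proof.
move=> A B AB; apply: ereal_inf_le_tmp => x [C CB <-{x}]; exists C => //.
exact: subset_trans AB CB.
Qed.

Let leb_outer_sigma_subadditive : sigma_subadditive leb_outer.
Proof.
move=> A; have [[i ioo]|] := pselect (exists i, leb_outer (A i) = +oo).
  rewrite (eseries_pinfty _ _ ioo) ?leey// => k _.
  by rewrite -ltNye (lt_le_trans _ (leb_outer_ge0 _)).
rewrite -forallNE => Aoo.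
suff add2e (e : {posnum R}) :
    leb_outer (\bigcup_k A k) <= \sum_(i <oo) leb_outer (A i) + e%:num%:E.
  by apply/lee_addgt0Pr => _/posnumP[].
rewrite (le_trans _ (epsilon_trick _ _ _))//.
pose P k (B : nat -> 'rV[R]_n.+1 * 'rV[R]_n.+1) := box_cover (A k) B /\
  \sum_(j <oo) (box_vol (B j).1 (B j).2)%:E <=
    leb_outer (A k) + (e%:num / (2 ^ k.+1)%:R)%:E.
have [G PG] : {G : nat -> nat -> 'rV[R]_n.+1 * 'rV[R]_n.+1 &
    forall k, P k (G k)}.
  apply: (@choice _ _ P) => k; rewrite /P.
  have fA : leb_outer (A k) \is a fin_num.
    by rewrite ge0_fin_numE ?leb_outer_ge0// ltey; apply/eqP; exact: Aoo.
  have e0 : (0 < e%:num / (2 ^ k.+1)%:R)%R by [].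
  have [_ [B AB <-] lB] := lb_ereal_inf_adherent e0 fA.
  by exists B; split => //; exact: ltW.
pose v (p : nat * nat) := (box_vol (G p.1 p.2).1 (G p.1 p.2).2)%:E : \bar R.
have v0 p : 0 <= v p by exact: vol_ge0.
apply: (@le_trans _ _ (\esum_(p in setT) v p)).
  have /card_esym/ppcard_eqP[f] := card_nat2.
  apply: ereal_inf_lbound; exists (fun k => G (f k).1 (f k).2).
    move=> t [i _ /((PG i).1 t)[j _ Gt]].
    by exists (f^-1%FUN (i, j)) => //=; rewrite invK ?inE.
  rewrite -(esum_pred_image v f xpredT) ?[fun=> _]set_true//.
  by rewrite image_eq.
rewrite (_ : esum _ _ = \sum_(i <oo) \sum_(j <oo) v (i, j)); last first.
  pose J : nat -> set (nat * nat) := fun i => [set (i, j) | j in setT].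
  rewrite (_ : setT = \bigcup_k J k); last first.
    by rewrite predeqE => -[a b]; split => // _; exists a => //; exists b.
  rewrite esum_bigcupT //=; last first.
    apply/trivIsetP => i j _ _ ij.
    rewrite predeqE => -[k m] /=; split => //= -[] [_] _ [<-{k} _].
    by move=> [m' _] [] /esym/eqP; rewrite (negbTE ij).
  rewrite -(image_id [set: nat]) -fun_true esum_pred_image//; last first.
    by move=> k _; exact: esum_ge0.
  apply: eq_eseriesr => /= j _.
  rewrite -(esum_pred_image v (pair j) predT)//=; last first.
    by move=> ? ? _ _; exact: (@can_inj _ _ _ snd).
  by congr esum; rewrite predeqE => -[a b]; split; move=> [i _ <-]; exists i.
apply: lee_lim.
- by apply: is_cvg_nneseries => k _ _; apply: nneseries_ge0.
- by apply: is_cvg_nneseries => k _ _; rewrite adde_ge0.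
- by near=> k; apply: lee_sum => i _; exact: (PG i).2.
Unshelve. all: by end_near. Qed.

HB.instance Definition _ := isOuterMeasure.Build R 'rV[R]_n.+1 leb_outer
  leb_outer0 leb_outer_ge0 le_leb_outer leb_outer_sigma_subadditive.

(* Lebesgue measure, on the sigma-algebra of Lebesgue measurable sets. As a
   function it is still the outer measure, so [leb A] is meaningful for every
   set A and no measurability of [T f] is needed below. *)
Definition leb : set (caratheodory_type leb_outer) -> \bar R := leb_outer.

Let leb_semi_sigma_additive : semi_sigma_additive leb.
Proof. exact: caratheodory_measure_sigma_additive. Qed.

HB.instance Definition _ := isMeasure.Build _ _ _ leb
  leb_outer0 leb_outer_ge0 leb_semi_sigma_additive.

End lebesgue_measure_rV.
Arguments leb_outer {R} n A.
Arguments leb {R} n.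

Section definitions.
Context {R : realType} {n : nat}.
Notation Rn := 'rV[R]_n.+1.
Notation mu := (@leb R n).
Implicit Types (x y a : Rn) (l s r : R) (Q : set Rn) (f g : Rn -> R)
  (k : Rn -> Rn -> R) (omega : R -> R) (T : (Rn -> R) -> Rn -> R).

Definition edist x y : R := Num.sqrt (\sum_i (x 0 i - y 0 i) ^+ 2).

Definition cube a l : set Rn := [set x | forall i, `|x 0 i - a 0 i| <= l / 2].

Definition is_cube Q := exists a l, 0 < l /\ Q = cube a l.

Definition dim_const (cn : R) :=
  forall a l, 0 < l -> forall m, (1 <= m)%N -> forall x x' y,
  cube a l x -> cube a l x' -> ~ cube a (2 ^+ m * l) y ->
  edist x x' / edist x y <= cn * 2 ^- m.

Definition Lebesgue_measurable f :=
  measurable_fun (setT : set (caratheodory_type (leb_outer n))) f.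

Definition in_Lr r f :=
  Lebesgue_measurable f /\ finite_norm mu r%:E f.

(* The case x = x' is left out because omega is a function on (0, +oo). *)
Definition kernel_regularity k omega := exists2 c : R, 0 < c &
  forall a l, 0 < l -> forall x x' y,
  cube a l x -> cube a l x' -> x != x' -> ~ cube a (2 * l) y ->
  `|k x y - k x' y| <=
    c * (edist x y ^+ n.+1)^-1 * omega (edist x x' / edist x y).

(* Principal value with truncation both near x and at infinity, so that T 1 can
   be meaningful (e.g. equal to 0) for kernels of size |x - y|^-(n.+1). *)
Definition annulus x (e N : R) : set Rn := [set y | e < edist x y < N].

Definition truncated k f x (p : R * R) : R :=
  (\int[mu]_(y in annulus x p.1 p.2) (k x y * f y))%R.

Definition pv_exists k f x :=
  (forall e N : R, 0 < e ->
    mu.-integrable (annulus x e N) (fun y => (k x y * f y)%:E)) /\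
  cvg (truncated k f x p @[p --> (0^'+, +oo)]).

(* Where the principal value does not exist, the value is irrelevant. *)
Definition singular_integral k f x : R :=
  lim (truncated k f x p @[p --> (0^'+, +oo)]).

Definition singular_integral_domain k f :=
  Lebesgue_measurable f /\ \forall x \ae mu, pv_exists k f x.

Definition annihilates_constants k := forall b : R,
  singular_integral_domain k (cst b) /\
  \forall x \ae mu, singular_integral k (cst b) x = 0.

Local Open Scope ereal_scope.

Definition weak_type r T := exists c : R, forall f, in_Lr r f ->
  forall lambda : R, (0 < lambda)%R ->
  (lambda `^ r)%:E * mu [set x | (lambda < `|T f x|)%R] <=
    c%:E * 'N[mu]_r%:E[EFin \o f] `^ r.

Definition avg Q f : \bar R := (mu Q)^-1 * \int[mu]_(y in Q) (f y)%:E.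

Definition HLmax f x : \bar R :=
  ereal_sup [set avg Q (fun y => `|f y|)%R | Q in [set Q | is_cube Q /\ Q x]].

Definition Mr r f x : \bar R := HLmax (fun y => `|f y| `^ r)%R x `^ r^-1.

Definition Msharp r f x : \bar R :=
  ereal_sup [set ereal_inf [set avg Q (fun y => `|f y - c| `^ r)%R `^ r^-1
                           | c in [set: R]]
            | Q in [set Q | is_cube Q /\ Q x]].

Definition local_osc s g Q : \bar R :=
  ereal_inf [set ereal_inf [set alpha%:E | alpha in
      [set alpha : R | (0 <= alpha)%R /\
        mu [set y | Q y /\ (alpha < `|g y - c|)%R] < s%:E * mu Q]]
    | c in [set: R]].

Definition M0sharp_in s Q0 g x : \bar R :=
  ereal_sup [set local_osc s g Q |
             Q in [set Q | [/\ is_cube Q, Q x & Q `<=` Q0]]].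

Definition M0sharp s g x : \bar R :=
  ereal_sup [set local_osc s g Q | Q in [set Q | is_cube Q /\ Q x]].

Definition sup_inf_in Q0 (h : Rn -> \bar R) x : \bar R :=
  ereal_sup [set ereal_inf [set h y | y in Q] |
             Q in [set Q | [/\ is_cube Q, Q x & Q `<=` Q0]]].

End definitions.
Arguments dim_const {R} n cn.

(* Main.v *)
Require Import Defs.
From mathcomp Require Import all_boot all_order all_algebra.
From mathcomp Require Import all_classical all_reals all_analysis.
From mathcomp Require Import measurable_realfun ring lra.
(* Makes [edist] denote the Euclidean distance. *)
Require Import Defs.
Import Order.TTheory GRing.Theory Num.Theory.
Import numFieldNormedType.Exports.
Set Implicit Arguments.
Unset Strict Implicit.
Unset Printing Implicit Defensive.
Local Open Scope classical_set_scope.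
Local Open Scope ring_scope.

(** The proof localizes on one cube Q, where the local oscillation of T f has to be
bounded by the infimum over Q of the maximal function. Let B exceed this infimum;
then some point of Q, contained in all the dilates 2^m Q, shows that the mean of
order r of f over each 2^m Q is at most B. Split f at 2 Q. The part in 2 Q has
L^r norm at most B |2 Q|^(1/r), so that by the weak-type inequality its image
exceeds C B on a set of measure less than s |Q| only. The image of the rest
varies by at most C B on Q: by regularity the difference of its values at two
points is at most the sum over m of omega (cn 2^-m) times the mean of |f| over
2^m Q, and the Dini condition says that the omega (cn 2^-m) have a finite sum
([dini_sum_bounded]). This is [local_osc_singular_integral_le].

When T annihilates constants, f is replaced by f - c with c adapted to 2 Q. The
mean of |f - c| over 2^m Q is then at most C m B ([mass_about_constant]), and the
logarithm in the second Dini condition absorbs the factor m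
([dini_log_sum_bounded]).

Two points need care. The principal values are limits of integrals over annuli
centred at the point of evaluation; for two points of Q the truncations at
infinity differ on a shell of radius N and bounded width, whose contribution has
to be bounded although T is applied to functions that need not decay. This takes
a bound on the size of the kernel, which is not among the hypotheses. It follows
from them: regularity makes k x y differ by at most C |x - y|^-(n+1) from its
values when x goes to infinity along suitable rays ([kernel_far_diff_le]), and if
these values did not tend to 0 for almost every y, then T would send the
indicator of some bounded set to a function that stays away from 0 on sets of
arbitrarily large measure, against the weak-type inequality
([ae_kernel_size]). Secondly, in the case of the sharp maximal function the means
over the balls of radius N grow like log N, so that the shell cannot be bounded
by the whole ball; among the many disjoint shells between the radii N and 3 N a
light one is chosen, and the limit is taken along such radii
([tail_oscillation]). *)

(** * Lebesgue measure of boxes and half-spaces *)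

Section lebesgue_measure.
Context {R : realType}.

Lemma itv_vol_ge0 (a b : R) : 0 <= Num.max 0 (b - a).
Proof. by rewrite le_max lexx. Qed.

(** Fubini's theorem by induction on the dimension: with the first coordinate
fixed, the boxes that meet the slice form a weighted cover in one dimension
less, and integrating the inequality obtained for the slices over the first
coordinate restores the missing factors. The weights v make the induction go
through; with v = 1, the boxes of a countable cover have at least the volume of
the covered box, and no compactness argument is involved. *)
Lemma prod_cover_le (d : nat) (lo hi : 'I_d -> R) (v : nat -> R)
    (a b : nat -> 'I_d -> R) :
  (forall k, 0 <= v k) ->
  (forall x : 'I_d -> R, (forall i, lo i < x i <= hi i) ->
    (1 <= \sum_(k <oo) (v k * \prod_i \1_(`]a k i, b k i]) (x i))%:E)%E) ->
  ((\prod_i Num.max 0 (hi i - lo i))%:E <=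
    \sum_(k <oo) (v k * \prod_i Num.max 0 (b k i - a k i))%:E)%E.
Proof.
elim: d lo hi v a b => [|d IH] lo hi v a b v0 H.
  have := H (fun=> 0) (fun i => match ltac:(by case: i) : False with end).
  rewrite big_ord0 => /le_trans; apply.
  by apply: lee_nneseries => // k _; rewrite ?lee_fin ?big_ord0 ?mulr1.
rewrite big_ord_recl.
set P := \prod_(i < d) _.
have P0 : 0 <= P by apply: prodr_ge0 => i _; exact: itv_vol_ge0.
pose w k := v k * \prod_(i < d) Num.max 0 (b k (lift ord0 i) - a k (lift ord0 i)).
have w0 k : 0 <= w k.
  by rewrite mulr_ge0 // prodr_ge0 // => i _; exact: itv_vol_ge0.
have ptw (t : R) : ((P * \1_(`]lo ord0, hi ord0]) t)%:E <=
    \sum_(k <oo) (w k * \1_(`]a k ord0, b k ord0]) t)%:E)%E.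
  have -> : \1_(`]lo ord0, hi ord0]) t = (t \in `]lo ord0, hi ord0])%:R :> R.
    by rewrite indicE mem_setE.
  case: (boolP (t \in _)) => [|_]; last first.
    rewrite mulr0; apply: nneseries_ge0 => k _ _.
    by rewrite lee_fin mulr_ge0.
  rewrite in_itv /= => tI; rewrite mulr1.
  have := IH (fun i => lo (lift ord0 i)) (fun i => hi (lift ord0 i))
    (fun k => v k * \1_(`]a k ord0, b k ord0]) t)
    (fun k i => a k (lift ord0 i)) (fun k i => b k (lift ord0 i)).
  move=> /(_ _ _)/le_trans; apply.
  - by move=> k; rewrite mulr_ge0.
  - move=> x xI.
    have := H (fun i => if unlift ord0 i is Some j then x j else t).
    move=> /(_ _)/le_trans; apply.
      by move=> i; case: unliftP => [j ->|->] //.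
    apply: lee_nneseries => // k _.
      by rewrite lee_fin mulr_ge0 // prodr_ge0.
    rewrite lee_fin big_ord_recl unlift_none mulrA ler_wpM2l ?mulr_ge0 //.
    by apply: ler_prod => i _; rewrite liftK lexx andbT.
  - apply: lee_nneseries => // k _.
      by rewrite lee_fin mulr_ge0 ?mulr_ge0 // prodr_ge0 // => i _; exact: itv_vol_ge0.
    by rewrite lee_fin /w -!mulrA (mulrC (\1_ _ _)).
have itvE (c d' : R) : (\int[@lebesgue_measure R]_t (\1_(`]c, d']) t)%:E =
    (Num.max 0 (d' - c))%:E)%E.
  rewrite integral_indic // setIT /= lebesgue_measure_itv /= lte_fin.
  case: ltP => cd; first by rewrite max_r // subr_ge0 ltW.
  by rewrite max_l // subr_le0.
have mind (c d' u : R) : measurable_fun [set: R]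
    (EFin \o (fun t : R => u * \1_(`]c, d']) t)).
  by apply/measurable_EFinP; apply: measurable_funM => //; exact: measurable_indic.
have intE (c d' u : R) : 0 <= u ->
  (\int[@lebesgue_measure R]_t (u * \1_(`]c, d']) t)%:E =
   (u * Num.max 0 (d' - c))%:E)%E.
  move=> u0; under eq_integral do rewrite EFinM.
  rewrite ge0_integralZl_EFin //=; last first.
    by apply/measurable_EFinP; exact: measurable_indic.
  by rewrite itvE EFinM.
have : (\int[@lebesgue_measure R]_t (P * \1_(`]lo ord0, hi ord0]) t)%:E <=
   \int[@lebesgue_measure R]_t
      \sum_(k <oo) (w k * \1_(`]a k ord0, b k ord0]) t)%:E)%E.
  apply: ge0_le_integral => //.
  - by move=> t _; rewrite lee_fin mulr_ge0.
  - exact: mind.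
  - by apply: ge0_emeasurable_sum => [k t _ _|k _]; [rewrite lee_fin mulr_ge0|exact: mind].
rewrite intE // mulrC integral_nneseries //; first last.
- by move=> k t _; rewrite lee_fin mulr_ge0.
- by move=> k; exact: mind.
move=> /le_trans; apply.
apply: lee_nneseries => [k _ _|k _].
  by apply: integral_ge0 => t _; rewrite lee_fin mulr_ge0.
by rewrite intE // lee_fin /w big_ord_recl -mulrA (mulrC (\prod_(i < d) _)).
Qed.

Context {n : nat}.
Local Notation Rn := 'rV[R]_n.+1.

Lemma box_vol_le_leb (a b : Rn) : ((box_vol a b)%:E <= leb n (box a b))%E.
Proof.
rewrite /leb /leb_outer; apply: le_ereal_inf_tmp => _ [B Bcov <-].
have := @prod_cover_le _ (fun i => a 0 i) (fun i => b 0 i) (fun=> 1)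
  (fun k i => (B k).1 0 i) (fun k i => (B k).2 0 i).
move=> /(_ _ _)/le_trans; apply=> //.
  move=> x xI.
  have [k _ Bk] : (\bigcup_k box (B k).1 (B k).2) (\row_i x i).
    by apply: Bcov => i; rewrite mxE.
  apply: le_trans (nneseries_lim_ge k.+1 _); last first.
    by move=> j _ _; rewrite lee_fin mul1r prodr_ge0.
  rewrite sumEFin lee_fin big_nat_recr //= mul1r [X in _ <= _ + X]big1 => [|i _].
    by rewrite lerDr sumr_ge0 // => j _; rewrite mul1r prodr_ge0.
  by rewrite indicE mem_set //= in_itv /=; have := Bk i; rewrite mxE.
by apply: lee_nneseries => [k _|k _]; rewrite mul1r // lee_fin box_vol_ge0.
Qed.

Lemma leb_box_le_vol (a b : Rn) : (leb n (box a b) <= (box_vol a b)%:E)%E.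
Proof.
rewrite /leb /leb_outer; apply: ereal_inf_lbound.
exists (fun k => if k is 0%N return Rn * Rn then (a, b) else (0, 0)).
  by move=> x xab; exists 0%N.
rewrite (nneseries_split 0 1) /=; last first.
  by move=> k _; rewrite lee_fin box_vol_ge0.
rewrite add0n big_nat1 /= eseries0 ?adde0 // => -[|k] //= _ _.
by rewrite /box_vol big_ord_recl !mxE subrr maxxx mul0r.
Qed.

(** Cutting the boxes of a cover along a coordinate hyperplane does not change
their total volume, which is Caratheodory's condition. *)
Lemma halfspace_measurable (i : 'I_n.+1) (t : R) :
  measurable ([set x | x 0 i <= t] : set (caratheodory_type (leb_outer n))).
Proof.
apply: le_caratheodory_measurable => /= A; rewrite [leRHS]/leb_outer.
apply: le_ereal_inf_tmp => _ [B Bcov <-].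
(* f acts on the coordinate that the hyperplane fixes. *)
pose cut (f : R -> R) (a : Rn) : Rn := \row_j if j == i then f (a 0 j) else a 0 j.
pose B1 k := ((B k).1, cut (fun u => Num.min u t) (B k).2).
pose B2 k := (cut (fun u => Num.max u t) (B k).1, (B k).2).
have c1 : box_cover (A `&` [set x | x 0 i <= t]) B1.
  move=> x [/Bcov [k _ xk] xt]; exists k => // j; have /andP[xa xb] := xk j.
  rewrite /= mxE xa /=; case: eqP => // jE.
  by rewrite le_min xb jE.
have c2 : box_cover (A `&` ~` [set x | x 0 i <= t]) B2.
  move=> x [/Bcov [k _ xk] /negP]; rewrite -ltNge => xt; exists k => // j.
  have /andP[xa xb] := xk j.
  rewrite /= mxE xb andbT; case: eqP => // jE.
  by rewrite gt_max xa jE.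
have volD k : box_vol (B1 k).1 (B1 k).2 + box_vol (B2 k).1 (B2 k).2 <=
    box_vol (B k).1 (B k).2.
  rewrite /box_vol [in leRHS](bigD1 i) //= [X in X + _](bigD1 i) //=.
  rewrite [X in _ + X](bigD1 i) //=.
  set P := (X in _ <= _ * X).
  under eq_bigr => j /negPf ji do rewrite mxE ji.
  under [X in _ + _ * X]eq_bigr => j /negPf ji do rewrite mxE ji.
  rewrite -mulrDl ler_wpM2r //.
    by apply: prodr_ge0 => j _; exact: itv_vol_ge0.
  rewrite !mxE eqxx; move: ((B k).1 0 i) ((B k).2 0 i) => u v.
  rewrite /Order.min /Order.max; do ! case: ifPn; rewrite -?leNgt; lra.
pose H : set Rn := [set x : Rn | x 0 i <= t].
have l1 : (leb_outer n (A `&` H) <=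
   \sum_(k <oo) (box_vol (B1 k).1 (B1 k).2)%:E)%E.
  by apply: ereal_inf_lbound; exists B1.
have l2 : (leb_outer n (A `&` ~` H) <=
   \sum_(k <oo) (box_vol (B2 k).1 (B2 k).2)%:E)%E.
  by apply: ereal_inf_lbound; exists B2.
apply: le_trans (leeD l1 l2) _.
rewrite -nneseriesD; [|by move=> k _ _; rewrite lee_fin box_vol_ge0..].
apply: lee_nneseries => k _.
  by rewrite -EFinD lee_fin addr_ge0 // box_vol_ge0.
by rewrite -EFinD lee_fin.
Qed.

End lebesgue_measure.

(** * Cubes and the Euclidean distance *)

Section cubes.
Context {R : realType} {n : nat}.
Local Notation Rn := 'rV[R]_n.+1.
Local Notation X := (caratheodory_type (@leb_outer R n)).
Implicit Types (x y z a : Rn) (l : R).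

Lemma norm_leP x (c : R) : 0 <= c ->
  (`|x| <= c) <-> (forall i, `|x 0 i| <= c).
Proof.
have -> : `|x| = mx_norm x by [].
move=> c0; rewrite mx_normrE; split => [H i|H].
  by apply: le_trans H; apply: (le_bigmax _ (fun ij => `|x ij.1 ij.2|) (ord0, i)).
by apply: bigmax_le => // -[i j] _ /=; rewrite (ord1 i).
Qed.

Lemma coord_le_norm x i : `|x 0 i| <= `|x|.
Proof. by move: i; apply/norm_leP. Qed.

Lemma cubeE a l x : 0 <= l -> cube a l x <-> `|x - a| <= l / 2.
Proof.
move=> l0; have l20 : 0 <= l / 2 by lra.
rewrite (norm_leP _ l20); split => H i; have := H i; by rewrite !mxE.
Qed.

Lemma edist_ge0 x y : 0 <= edist x y. Proof. exact: sqrtr_ge0. Qed.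

Lemma norm_le_edist x y : `|x - y| <= edist x y.
Proof.
apply/(norm_leP _ (edist_ge0 x y)) => i; rewrite !mxE -sqrtr_sqr ler_wsqrtr //.
by rewrite (bigD1 i) //= lerDl sumr_ge0 // => j _; exact: sqr_ge0.
Qed.

Lemma edist_le_norm x y : edist x y <= n.+1%:R * `|x - y|.
Proof.
have N0 : 0 <= n.+1%:R * `|x - y| :> R by rewrite mulr_ge0.
rewrite -[leRHS]ger0_norm // -sqrtr_sqr ler_wsqrtr //.
apply: (@le_trans _ _ (\sum_(i < n.+1) `|x - y| ^+ 2)).
  apply: ler_sum => i _; rewrite -[leLHS]real_normK ?num_real //.
  by rewrite lerXn2r ?nnegrE //; have := coord_le_norm (x - y) i; rewrite !mxE.
rewrite sumr_const card_ord -[leLHS]mulr_natl exprMn ler_wpM2r ?sqr_ge0 //.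
by rewrite -natrX ler_nat leq_pmulr.
Qed.

Lemma edist_gt0 x y : x != y -> 0 < edist x y.
Proof.
move=> xy; apply: lt_le_trans (norm_le_edist x y).
by rewrite normr_gt0 subr_eq0.
Qed.

Lemma edistxx x : edist x x = 0.
Proof.
apply/eqP; rewrite eq_le edist_ge0 andbT.
by have := edist_le_norm x x; rewrite subrr normr0 mulr0.
Qed.

(** Factoring the difference of the squared distances coordinatewise avoids
Minkowski's inequality, at the price of a dimensional constant. *)
Lemma edist_lipschitz x x' z :
  `|edist x z - edist x' z| <= n.+1%:R * `|x - x'|.
Proof.
have [->|ne] := eqVneq x x'; first by rewrite subrr normr0 mulr_ge0.
have D0 : 0 < edist x z + edist x' z.
  have [xz|xz] := eqVneq x z; last by rewrite ltr_pwDl ?edist_gt0 ?edist_ge0.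
  by rewrite ltr_wpDl ?edist_ge0 // edist_gt0 // -xz eq_sym.
rewrite -(ler_pM2r D0) -[X in _ * X <= _](gtr0_norm D0) -normrM -subr_sqr.
rewrite !sqr_sqrtr ?sumr_ge0 // => [|i _|i _]; rewrite ?sqr_ge0 //.
rewrite -sumrB; apply: le_trans (ler_norm_sum _ _ _) _.
rewrite -mulrA mulr_natl -[X in _ *+ X](card_ord n.+1) -sumr_const.
apply: ler_sum => i _.
rewrite subr_sqr normrM ler_pM //.
  by have := coord_le_norm (x - x') i; rewrite !mxE; congr (`|_| <= _); ring.
apply: le_trans (ler_normD _ _) _; apply: lerD.
  by apply: le_trans (norm_le_edist _ _); have := coord_le_norm (x - z) i; rewrite !mxE.
by apply: le_trans (norm_le_edist _ _); have := coord_le_norm (x' - z) i; rewrite !mxE.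
Qed.

Lemma measurable_coord i : measurable_fun [set: X] (fun x : X => (x : Rn) 0 i).
Proof.
apply: (measurability _ (RGenOInfty.measurableE R)) => //.
move=> _ [_ [t ->] <-]; rewrite setTI.
have -> : (fun x : X => (x : Rn) 0 i) @^-1` `]t, +oo[ =
    ~` ([set x : X | (x : Rn) 0 i <= t]).
  by apply/seteqP; split => x /=; rewrite in_itv /= andbT ltNge => /negP.
by apply: measurableC; exact: halfspace_measurable.
Qed.

Lemma measurable_edist x : measurable_fun [set: X] (fun z : X => edist x z).
Proof.
apply: (@measurableT_comp _ _ _ _ _ _ (@Num.sqrt R)).
  by apply: continuous_measurable_fun; exact: sqrt_continuous.
apply: measurable_sum => i; apply: measurable_funX.
apply: measurable_funB; [exact: measurable_cst|exact: measurable_coord].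
Qed.

Lemma measurable_annulus x (e N : R) : measurable (annulus x e N : set X).
Proof.
have -> : (annulus x e N : set X) = [set: X] `&` (fun z : X => edist x z) @^-1` `]e, N[.
  by rewrite setTI; apply/seteqP; split => z; rewrite /annulus /= in_itv.
exact: measurable_edist.
Qed.

Lemma measurable_cube a l : measurable (cube a l : set X).
Proof.
have -> : (cube a l : set X) = \bigcap_(i in [set: 'I_n.+1])
    ([set: X] `&` (fun x : X => (x : Rn) 0 i) @^-1` `[a 0 i - l / 2, a 0 i + l / 2]).
  apply/seteqP; split => x /=.
    move=> xQ i _; split => //=; have := xQ i.
    by rewrite in_itv /= ler_distl.
  by move=> H i; have [_] := H i I; rewrite /= in_itv /= ler_distl.
by apply: fin_bigcap_measurable => // i _; exact: measurable_coord.
Qed.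

Lemma leb_cube_ge a l : 0 < l -> ((l ^+ n.+1)%:E <= leb n (cube a l))%E.
Proof.
move=> l0.
have -> : l ^+ n.+1 = box_vol (a - const_mx (l / 2)) (a + const_mx (l / 2)).
  rewrite /box_vol -[X in l ^+ X]card_ord -prodr_const; apply: eq_bigr => i _.
  rewrite !mxE max_r; [by field|lra].
apply: le_trans (box_vol_le_leb _ _) _; apply: le_outer_measure => x xb i.
by have := xb i; rewrite !mxE ler_distl => /andP[/ltW -> ->].
Qed.

(** The half-open boxes that define the measure miss the lower faces of a closed
cube; the factor 2 leaves room for them. *)
Lemma leb_cube_le a l : 0 < l -> (leb n (cube a l) <= ((2 * l) ^+ n.+1)%:E)%E.
Proof.
move=> l0.
have -> : (2 * l) ^+ n.+1 = box_vol (a - const_mx l) (a + const_mx l).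
  rewrite /box_vol -[X in _ ^+ X]card_ord -prodr_const; apply: eq_bigr => i _.
  rewrite !mxE max_r; [by ring|lra].
apply: le_trans (leb_box_le_vol _ _); apply: le_outer_measure => x xb i.
have := xb i; rewrite !mxE ler_distl => /andP[x1 x2]; apply/andP; split; lra.
Qed.

Lemma leb_cube_fin a l : 0 < l -> leb n (cube a l) \is a fin_num.
Proof.
move=> l0; rewrite ge0_fin_numE //.
by apply: le_lt_trans (leb_cube_le _ l0) _; rewrite ltry.
Qed.

Lemma leb_cube_gt0 a l : 0 < l -> (0 < leb n (cube a l))%E.
Proof.
by move=> l0; apply: lt_le_trans (leb_cube_ge a l0); rewrite lte_fin exprn_gt0.
Qed.

End cubes.

(** * Principal values and integration almost everywhere *)

Section principal_values.
Context {R : realType} {n : nat}.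
Local Notation Rn := 'rV[R]_n.+1.
Local Notation X := (caratheodory_type (@leb_outer R n)).
Local Notation mu := (@leb R n).
Implicit Types (x y z a : Rn) (f g : Rn -> R) (k : Rn -> Rn -> R).

(** In this form the two truncation parameters can be chosen one after the
other, N along any sequence that tends to infinity. *)
Lemma pv_approx k f x (eps : R) : pv_exists k f x -> 0 < eps ->
  exists2 e0, 0 < e0 & exists N0, forall e N, 0 < e < e0 -> N0 < N ->
    `|truncated k f x (e, N) - singular_integral k f x| < eps.
Proof.
move=> [_ cf] eps0.
have : truncated k f x p @[p --> (0^'+, +oo)] --> singular_integral k f x by [].
move=> /cvgrPdist_lt /(_ _ eps0) [[A B] /= [A0 B0]] AB.
have [e0 /= e00 e0A] : exists2 e, 0 < e & forall t, 0 < t < e -> A t.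
  move: A0 => [e /= e0 eA]; exists e => // t /andP[t0 te].
  by apply: eA => //=; rewrite sub0r normrN gtr0_norm.
have [N0 [_ N0B]] := B0.
exists e0 => //; exists N0 => e N ee NN; rewrite distrC.
by apply: (AB (e, N)); split => /=; [exact: e0A|exact: N0B].
Qed.

Lemma truncatedB k f g x (e N : R) : 0 < e ->
  pv_exists k f x -> pv_exists k g x ->
  truncated k (f \- g) x (e, N) = truncated k f x (e, N) - truncated k g x (e, N).
Proof.
move=> e0 [If _] [Ig _].
rewrite /truncated /= -RintegralB; [|exact: measurable_annulus|exact: If|exact: Ig].
by apply: eq_Rintegral => z _; rewrite mulrBr.
Qed.

Lemma pv_existsB k f g x : pv_exists k f x -> pv_exists k g x ->
  pv_exists k (f \- g) x /\
  singular_integral k (f \- g) x = singular_integral k f x - singular_integral k g x.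
Proof.
move=> pf pg; have [[If cf] [Ig cg]] := (pf, pg).
have lim : truncated k (f \- g) x p @[p --> (0^'+, +oo)] -->
    (singular_integral k f x - singular_integral k g x).
  apply: cvg_trans (cvgB cf cg); apply: near_eq_cvg.
  exists ([set e | 0 < e], setT); first by split => /=; [exact: nbhs_right_gt|exact: filterT].
  by move=> [e N] [/= e0 _]; rewrite truncatedB.
split; last exact/cvg_lim.
split; last exact/cvgP/lim.
move=> e N e0; apply: eq_integrable (integrableB _ (If e N e0) (Ig e N e0)).
- exact: measurable_annulus.
- by move=> z _ /=; rewrite mulrBr.
- exact: measurable_annulus.
Qed.

Lemma Rintegral_dist_le (F G Psi : X -> R) (B : R) :
  mu.-integrable setT (EFin \o F) -> mu.-integrable setT (EFin \o G) ->
  measurable_fun setT Psi -> (forall z, 0 <= Psi z) ->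
  (\forall z \ae mu, `|F z - G z| <= Psi z) ->
  (\int[mu]_z (Psi z)%:E <= B%:E)%E ->
  `|\int[mu]_z F z - \int[mu]_z G z| <= B.
Proof.
move=> iF iG mPsi Psi0 FG PB.
have iFG : mu.-integrable setT (EFin \o (fun z => F z - G z)).
  by apply: eq_integrable (integrableB _ iF iG).
rewrite -RintegralB //; apply: le_trans (le_normr_Rintegral _ iFG) _ => //.
rewrite -lee_fin; apply: le_trans PB.
have mFG : measurable_fun setT (fun z : X => F z - G z).
  by apply/measurable_EFinP; exact: measurable_int iFG.
rewrite /Rintegral fineK.
  apply: ae_ge0_le_integral.
  - exact: measurableT.
  - by move=> z _; rewrite lee_fin.
  - by apply/measurable_EFinP; exact: measurableT_comp.
  - by move=> z _; rewrite lee_fin.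
  - exact/measurable_EFinP.
  - by apply: filterS FG => z; rewrite lee_fin.
apply: integrable_fin_num => //; exact: integrable_norm.
Qed.

Lemma LnormX (r : R) f : 1 <= r ->
  ('N[mu]_r%:E[EFin \o f] `^ r = \int[mu]_z (`|f z| `^ r)%:E)%E.
Proof.
move=> r1; have r0 : 0 < r by lra.
rewrite Lnorm.unlock -poweRrM mulVf ?gt_eqF // poweRe1.
  by apply: eq_integral => z _; rewrite poweR_EFin.
by apply: integral_ge0 => z _; exact: poweR_ge0.
Qed.

Lemma in_LrP (r : R) f : 1 <= r -> Lebesgue_measurable f ->
  (\int[mu]_z (`|f z| `^ r)%:E < +oo)%E -> in_Lr r f.
Proof.
move=> r1 mf If; have r0 : 0 < r by lra.
split => //; rewrite /finite_norm ltNge leye_eq; apply/negP => /eqP N.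
by move: If; rewrite -LnormX // N poweRyr ?gt_eqF // ltxx.
Qed.

Lemma ae_imp (P Q : Rn -> Prop) : (forall x, P x -> Q x) ->
  (\forall x \ae mu, P x) -> \forall x \ae mu, Q x.
Proof. by move=> PQ; apply: negligibleS => x /= nQ /PQ. Qed.

Lemma ae_and (P Q : Rn -> Prop) : (\forall x \ae mu, P x) ->
  (\forall x \ae mu, Q x) -> \forall x \ae mu, P x /\ Q x.
Proof.
move=> aP aQ; apply: negligibleS (negligibleU aP aQ) => x /= /not_andP[]; tauto.
Qed.

Lemma integrable_indic_fin (A : set Rn) : measurable (A : set X) ->
  (leb n A < +oo)%E -> mu.-integrable setT (EFin \o (\1_A : X -> R)).
Proof.
move=> mA Afin; apply/integrableP; split.
  by apply/measurable_EFinP; exact: measurable_indic.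
rewrite (eq_integral (fun z : X => (\1_(A : set X) z)%:E)).
  by rewrite integral_indic // setIT.
by move=> z _ /=; rewrite ger0_norm.
Qed.

Lemma integrable_scale (D : set Rn) (c : R) f : measurable (D : set X) ->
  mu.-integrable D (EFin \o f) -> mu.-integrable D (EFin \o (fun z => c * f z)).
Proof.
by move=> mD If; apply: eq_integrable (integrableZl mD c If) => // z _ /=; rewrite EFinM.
Qed.

Lemma ae_cube_ex (P : Rn -> Prop) a (l : R) : 0 < l ->
  (\forall x \ae mu, P x) -> exists2 x, cube a l x & P x.
Proof.
move=> l0 [N [mN N0 PN]]; apply: contrapT => nex.
have : (leb n (cube a l) <= leb n N)%E.
  apply: le_outer_measure => x xQ; apply: PN => Px; apply: nex; by exists x.
rewrite N0 leNgt => /negP; apply; exact: leb_cube_gt0.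
Qed.

(** The sets A and B are arbitrary: T f is known almost everywhere only, and
nothing is known about the measurability of its level sets. *)
Lemma measure_ae_le (A B : set Rn) (P : Rn -> Prop) :
  (\forall x \ae mu, P x) -> (forall x, P x -> A x -> B x) ->
  (leb n A <= leb n B)%E.
Proof.
move=> [N [mN N0 PN]] AB.
apply: (@le_trans _ _ (leb n (B `|` N))).
  apply: le_outer_measure => x Ax.
  have [Px|nPx] := pselect (P x); [left; exact: AB|right; exact: PN].
apply: le_trans (outer_measureU2 _ _ _) _.
by rewrite [X in (_ + X <= _)%E](_ : _ = 0%E) ?adde0.
Qed.

Lemma measurable_absr g : Lebesgue_measurable g ->
  measurable_fun [set: X] (fun z : X => `|g z|).
Proof. by move=> mg; apply: measurableT_comp; [exact: normr_measurable|exact: mg]. Qed.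

End principal_values.

(** * The kernel when its first variable moves away *)

Section kernel_size.
Context {R : realType} {n : nat}.
Local Notation Rn := 'rV[R]_n.+1.
Local Notation X := (caratheodory_type (@leb_outer R n)).
Local Notation mu := (@leb R n).
Implicit Types (x y z a : Rn).
Context (k : Rn -> Rn -> R) (omega : R -> R)
  (omega_nd : forall t u : R, 0 < t -> t <= u -> omega t <= omega u)
  (hk : kernel_regularity k omega).

(** At every small t, regularity bounds a nonnegative quantity by a positive
multiple of omega t, since all small ratios of distances occur. *)
Lemma omega_ge0 t : 0 < t -> 0 <= omega t.
Proof.
move=> t0; have [c c0 H] := hk.
pose h : R := Num.min (1 / 4) (t / n.+1%:R).
have h0 : 0 < h by rewrite lt_min; apply/andP; split; [lra|exact: divr_gt0].
have h4 : h <= 1 / 4 by rewrite ge_min lexx.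
pose x : Rn := const_mx 1; pose x' : Rn := const_mx (1 + h).
have ne : x != x'.
  by apply/eqP => /rowP /(_ ord0); rewrite !mxE => E; lra.
have e1 : 1 <= edist x 0.
  apply: le_trans (norm_le_edist _ _); have := coord_le_norm (x - 0) ord0.
  by rewrite !mxE subr0 normr1.
have e2 : 0 < edist x x' by exact: edist_gt0.
have e3 : edist x x' / edist x 0 <= t.
  rewrite ler_pdivrMr; last exact: lt_le_trans e1.
  apply: (@le_trans _ _ (n.+1%:R * h)).
    apply: le_trans (edist_le_norm _ _) _; rewrite ler_wpM2l //.
    apply/norm_leP; first exact: ltW.
    by move=> i; rewrite !mxE opprD addNKr normrN gtr0_norm.
  apply: (@le_trans _ _ t); last by rewrite ler_peMr // ltW.
  by rewrite mulrC -ler_pdivlMr // ge_min lexx orbT.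
have e4 : 0 < edist x x' / edist x 0 by rewrite divr_gt0 // (lt_le_trans _ e1).
have := H x (2 * h) ltac:(lra) x x' 0.
move=> /(_ _ _ ne _)/(le_trans (normr_ge0 _)) H1.
apply: le_trans (omega_nd e4 e3).
rewrite -(@pmulr_rge0 _ (c * (edist x 0 ^+ n.+1)^-1)).
  apply: H1.
  - by move=> i; rewrite subrr normr0; lra.
  - by move=> i; rewrite !mxE addrAC subrr add0r gtr0_norm; lra.
  - move=> /(_ ord0); rewrite !mxE sub0r normrN normr1; lra.
by rewrite mulr_gt0 // invr_gt0 exprn_gt0 // (lt_le_trans _ e1).
Qed.

(** Regularity with cubes written as balls of the maximum norm, and with any
upper bound u of the ratio of distances. *)
Lemma kernel_diff_le : exists2 c : R, 0 < c &
  forall a h x x' y u, 0 < h -> `|x - a| <= h -> `|x' - a| <= h ->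
   2 * h < `|y - a| -> 0 < u -> edist x x' / edist x y <= u ->
   `|k x y - k x' y| <= c * (edist x y ^+ n.+1)^-1 * omega u.
Proof.
have [c c0 H] := hk; exists c => // a h x x' y u h0 xa xa' ya u0 eu.
have [->|ne] := eqVneq x x'.
  rewrite subrr normr0 mulr_ge0 ?omega_ge0 // mulr_ge0 ?invr_ge0 ?exprn_ge0 ?edist_ge0 //.
  exact: ltW.
have exy : 0 < edist x y.
  apply: edist_gt0; apply/eqP => E; move: ya; rewrite -E; lra.
apply: le_trans (H a (2 * h) _ x x' y _ _ ne _) _; first lra.
- by apply/cubeE; lra.
- by apply/cubeE; lra.
- by move/cubeE => /(_ ltac:(lra)); lra.
rewrite ler_wpM2l ?mulr_ge0 ?invr_ge0 ?exprn_ge0 ?edist_ge0 ?(ltW c0) //.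
by apply: omega_nd => //; rewrite divr_gt0 // edist_gt0.
Qed.

Lemma edist_scale y v (s t : R) :
  edist (y + s *: v) (y + t *: v) = `|s - t| * edist v 0.
Proof.
rewrite /edist -sqrtr_sqr -sqrtrM ?sqr_ge0 // mulr_sumr; congr Num.sqrt.
by apply: eq_bigr => i _; rewrite !mxE; ring.
Qed.

Lemma edistB x y : edist (x - y) 0 = edist x y.
Proof. by rewrite /edist; congr Num.sqrt; apply: eq_bigr => i _; rewrite !mxE subr0. Qed.

(** When the first variable moves away from the second one along a ray, in steps
that double the distance, the successive changes of the kernel form a geometric
series. So k x y differs by at most the standard size of a singular kernel from
the values far away on the ray, and even from those near the last point of the
ray, in a ball whose measure grows with j. *)
Lemma kernel_far_diff_le : exists2 C : R, 0 < C &
  forall x y x' (j : nat), x != y ->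
    `|x' - (y + 2 ^+ j *: (x - y))| <= 2 ^+ j * `|x - y| / 4 ->
  `|k x y - k x' y| <= C * (edist x y ^+ n.+1)^-1.
Proof.
have [c c0 H] := kernel_diff_le.
have o1 : 0 <= omega 1 by exact: omega_ge0.
have oN : 0 <= omega n.+1%:R by exact: omega_ge0.
exists (c * (2 * omega 1 + omega n.+1%:R) + 1) => [|x y x' j xy x'P].
  by rewrite ltr_pwDr // mulr_ge0 ?addr_ge0 ?mulr_ge0 // ltW.
pose v := x - y.
have v0 : 0 < `|v| by rewrite normr_gt0 subr_eq0.
have e0 : 0 < edist x y by exact: edist_gt0.
set K := (edist x y ^+ n.+1)^-1.
have K0 : 0 < K by rewrite invr_gt0 exprn_gt0.
have p0 i : 0 < 2 ^+ i :> R by rewrite exprn_gt0.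
have p1 i : 1 <= 2 ^+ i :> R by rewrite exprn_ege1 // ler1n.
have edE i : edist (y + 2 ^+ i *: v) y = 2 ^+ i * edist x y.
  by have := edist_scale y v (2 ^+ i) 0; rewrite scale0r addr0 subr0 gtr0_norm // edistB.
have nE (t : R) : 0 <= t -> `|t *: v| = t * `|v| by move=> ?; rewrite normrZ ger0_norm.
have Kle i : (edist (y + 2 ^+ i *: v) y ^+ n.+1)^-1 <= K * (2 ^+ i)^-1.
  rewrite edE exprMn invfM mulrC ler_wpM2l ?(ltW K0) // lef_pV2 ?posrE ?exprn_gt0 //.
  by rewrite exprS; apply: ler_peMr; [exact: ltW|exact: exprn_ege1].
(* The cube of the i-th step is centred at the midpoint of its endpoints, at
   distance 3/2 2^i |v| from y, and has half-side 2^i |v| / 2. *)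
have step i : `|k (y + 2 ^+ i *: v) y - k (y + 2 ^+ i.+1 *: v) y| <=
    c * (K * (2 ^+ i)^-1) * omega 1.
  have := H (y + (3 / 2 * 2 ^+ i) *: v) (2 ^+ i / 2 * `|v|)
    (y + 2 ^+ i *: v) (y + 2 ^+ i.+1 *: v) y 1.
  have -> : y + 2 ^+ i *: v - (y + (3 / 2 * 2 ^+ i) *: v) = - ((2 ^+ i / 2) *: v).
    by apply/rowP => m; rewrite !mxE; field.
  have -> : y + 2 ^+ i.+1 *: v - (y + (3 / 2 * 2 ^+ i) *: v) = (2 ^+ i / 2) *: v.
    by apply/rowP => m; rewrite !mxE exprS; field.
  have -> : y - (y + (3 / 2 * 2 ^+ i) *: v) = - ((3 / 2 * 2 ^+ i) *: v).
    by rewrite opprD addrA subrr add0r.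
  have pi0 := p0 i.
  have pv0 : 0 < 2 ^+ i * `|v| by rewrite mulr_gt0.
  rewrite !normrN !nE; [|lra|lra].
  move=> /(_ _ _ _ _ _ _)/le_trans; apply => //.
  - lra.
  - lra.
  - rewrite edist_scale edE edistB (_ : `|_| = 2 ^+ i); last first.
      by rewrite exprS (_ : _ - _ = - 2 ^+ i) ?normrN ?gtr0_norm //; ring.
    by rewrite divff // gt_eqF // mulr_gt0.
  by rewrite ler_wpM2r // ler_wpM2l // ltW.
have chain i : `|k x y - k (y + 2 ^+ i *: v) y| <=
    c * K * omega 1 * (2 - 2 * (2 ^+ i)^-1).
  elim: i => [|i IH].
    by rewrite expr0 scale1r [y + v]addrC subrK subrr normr0 invr1 mulr1 subrr mulr0.
  rewrite -(subrKA (k (y + 2 ^+ i *: v) y)); apply: le_trans (ler_normD _ _) _.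
  apply: le_trans (lerD IH (step i)) _.
  rewrite le_eqVlt; apply/orP; left; apply/eqP; rewrite exprS.
  by have := p0 i => /gt_eqF/negbT pi; field.
have last_step : `|k (y + 2 ^+ j *: v) y - k x' y| <= c * K * omega n.+1%:R.
  have pj := p0 j.
  have pv0 : 0 < 2 ^+ j * `|v| by rewrite mulr_gt0.
  have := H (y + 2 ^+ j *: v) (2 ^+ j * `|v| / 4) (y + 2 ^+ j *: v) x' y n.+1%:R.
  move=> /(_ _ _ _ _ _ _)/le_trans; apply => //.
  - lra.
  - by rewrite subrr normr0; lra.
  - by rewrite opprD addrA subrr add0r normrN nE ?ltW //; lra.
  - rewrite ler_pdivrMr; last by rewrite edE mulr_gt0.
    apply: le_trans (edist_le_norm _ _) _; rewrite ler_wpM2l // distrC.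
    apply: le_trans x'P _; apply: (@le_trans _ _ (2 ^+ j * `|v|)); first by rewrite /v; lra.
    by rewrite edE ler_wpM2l ?(ltW pj) // norm_le_edist.
  rewrite ler_wpM2r // ler_wpM2l ?(ltW c0) //; apply: le_trans (Kle j) _.
  by rewrite ler_piMr ?(ltW K0) // invf_le1.
rewrite -(subrKA (k (y + 2 ^+ j *: v) y)); apply: le_trans (ler_normD _ _) _.
apply: le_trans (lerD (chain j) last_step) _.
apply: (@le_trans _ _ (c * K * omega 1 * 2 + c * K * omega n.+1%:R)); last first.
  rewrite [leRHS](_ : _ = c * K * omega 1 * 2 + c * K * omega n.+1%:R + K).
    by rewrite lerDl ltW.
  by ring.
rewrite lerD2r ler_wpM2l ?mulr_ge0 ?(ltW c0) ?(ltW K0) //.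
by rewrite gerBl mulr_ge0 // invr_ge0 ltW.
Qed.

End kernel_size.

(** * Size of the kernel *)

Section calderon_zygmund_size.
Context {R : realType} {n : nat}.
Local Notation Rn := 'rV[R]_n.+1.
Local Notation X := (caratheodory_type (@leb_outer R n)).
Local Notation mu := (@leb R n).
Implicit Types (x y z a : Rn).
Context (k : Rn -> Rn -> R) (omega : R -> R) (r : R)
  (omega_nd : forall t u : R, 0 < t -> t <= u -> omega t <= omega u)
  (hk : kernel_regularity k omega) (hr : 1 <= r)
  (T_on_Lr : forall f : Rn -> R, in_Lr r f -> singular_integral_domain k f)
  (T_weak : weak_type r (singular_integral k)).

Lemma integral_indic_powR (A : set Rn) : measurable (A : set X) ->
  (\int[mu]_z (`|\1_A z : R| `^ r)%:E = leb n A)%E.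
Proof.
move=> mA; have r0 : r != 0 by rewrite gt_eqF // (lt_le_trans ltr01).
rewrite (eq_integral (fun z : X => (\1_(A : set X) z)%:E)); last first.
  move=> z _; rewrite indicE; case: (_ \in _); first by rewrite normr1 powR1.
  by rewrite normr0 powR0.
by rewrite integral_indic // setIT.
Qed.

Lemma indic_in_Lr (A : set Rn) : measurable (A : set X) -> (leb n A < +oo)%E ->
  in_Lr r (\1_A : Rn -> R).
Proof.
move=> mA Afin; apply: in_LrP => //; first exact: measurable_indic.
by rewrite integral_indic_powR.
Qed.

Lemma annulus_sub_cube x (e N l : R) : 0 <= l -> `|x| + N <= l / 2 ->
  annulus x e N `<=` cube 0 l.
Proof.
move=> l0 Nl y /andP[_ yN]; apply/cubeE => //; rewrite subr0.
have := ler_distD x y 0; rewrite !subr0 => /le_trans; apply.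
by have := norm_le_edist x y; rewrite distrC; lra.
Qed.

(** Testing T on the indicators of growing cubes shows that almost every k x is
measurable and integrable away from x. *)
Lemma ae_kernel_integrable : \forall x \ae mu, forall e N, 0 < e ->
  mu.-integrable (annulus x e N) (fun y => (k x y)%:E).
Proof.
have : \forall x \ae mu, forall j : nat, pv_exists k (\1_(cube 0 j.+1%:R)) x.
  apply: ae_foralln => j; apply: (T_on_Lr _).2; apply: indic_in_Lr.
    exact: measurable_cube.
  by apply: le_lt_trans (leb_cube_le _ _) _; rewrite ?ltry.
apply: ae_imp => x H e N e0.
pose j := Num.trunc (2 * (`|x| + `|N|)).
have sub : annulus x e N `<=` cube 0 j.+1%:R.
  apply: annulus_sub_cube => //.
  have : 2 * (`|x| + `|N|) < j.+1%:R by exact: truncnS_gt.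
  have := ler_norm N; lra.
apply: eq_integrable ((H j).1 e N e0); first exact: measurable_annulus.
move=> y /[!inE] /sub yQ /=.
by rewrite indicE mem_set ?mulr1.
Qed.

(** If the kernel, with the sign sg, exceeded twice the standard size on a set E
of positive measure, then by [kernel_far_diff_le] it would stay above the
standard size on E when its first variable moves to cubes of arbitrarily large
measure. There T applied to the indicator of E would stay away from 0, which the
weak-type inequality excludes. Restricting E to a cube that is small with respect
to its distance to x makes the same far away cubes serve all the points of E. *)
Lemma kernel_large_null (C : R) x y0 (sg : R) : 0 < C -> x != y0 ->
  (forall x y x' (j : nat), x != y ->
    `|x' - (y + 2 ^+ j *: (x - y))| <= 2 ^+ j * `|x - y| / 4 ->
    `|k x y - k x' y| <= C * (edist x y ^+ n.+1)^-1) ->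
  `|sg| = 1 ->
  (forall e N, 0 < e -> mu.-integrable (annulus x e N) (fun y => (k x y)%:E)) ->
  mu.-negligible [set y | cube y0 (`|x - y0| / 8) y /\
                          2 * C < sg * k x y * edist x y ^+ n.+1].
Proof.
move=> C0 xy0 farP sg1 Ik.
set rho := `|x - y0|; have rho0 : 0 < rho by rewrite normr_gt0 subr_eq0.
pose N1 := n.+1%:R * (2 * rho).
pose Q0 := cube y0 (rho / 8); pose D := annulus x (rho / 2) N1.
have nS : 1 <= n.+1%:R :> R by rewrite ler1n.
have Q0near y : Q0 y -> `|y - y0| <= rho / 16.
  by move/cubeE => /(_ ltac:(lra)); lra.
have Q0low y : Q0 y -> 15 / 16 * rho <= `|x - y|.
  by move=> /Q0near; have := ler_distD y x y0; rewrite -/rho; lra.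
have Q0D : Q0 `<=` D.
  move=> y Qy; have h1 := Q0low y Qy; have h2 := norm_le_edist x y.
  apply/andP; split; first lra.
  apply: le_lt_trans (edist_le_norm _ _) _; rewrite ltr_pM2l ?ltr0n //.
  have := ler_distD y0 x y; rewrite -/rho (distrC y0 y); have := Q0near y Qy; lra.
set E : set Rn := [set y | _].
have EQ : E `<=` Q0 by move=> y [].
have mk : measurable_fun (D : set X) (fun y : X => sg * k x y * edist x y ^+ n.+1).
  apply: measurable_funM.
    apply: measurable_funM; first exact: measurable_cst.
    by apply/measurable_EFinP; apply: measurable_int (Ik _ _ _); lra.
  by apply: measurable_funX; apply: measurable_funTS; exact: measurable_edist.
have mE : measurable (E : set X).
  have -> : (E : set X) = Q0 `&` (D `&`
      (fun y : X => sg * k x y * edist x y ^+ n.+1) @^-1` `]2 * C, +oo[).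
    apply/seteqP; split => y /=.
      by move=> [Qy Hy]; split => //; split; [exact: Q0D|rewrite in_itv /= andbT].
    by move=> [Qy [_]]; rewrite in_itv /= andbT.
  apply: measurableI; first exact: measurable_cube.
  by apply: mk; [exact: measurable_annulus|exact: measurable_itv].
have Efin : (leb n E < +oo)%E.
  apply: le_lt_trans (le_outer_measure _ _ _ EQ) _.
  apply: le_lt_trans (leb_cube_le _ _) _; [lra|by rewrite ltry].
apply/negligibleP => //; apply/eqP; rewrite eq_le measure_ge0 andbT leNgt.
apply/negP => Epos.
pose m := fine (leb n E).
have mEE : m%:E = leb n E by rewrite fineK // ge0_fin_numE.
have m0 : 0 < m by rewrite -lte_fin mEE.
have N10 : 0 < N1 by rewrite mulr_gt0 ?ltr0n //; lra.
pose lam := C * (N1 ^+ n.+1)^-1 * m.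
have CN0 : 0 < C * (N1 ^+ n.+1)^-1 by rewrite mulr_gt0 // invr_gt0 exprn_gt0.
have lam0 : 0 < lam by rewrite mulr_gt0.
(* lam bounds below the integral of the kernel over E, and half of it is left
   once the principal value is approximated within lam / 4. *)
have key (j : nat) x' : pv_exists k (\1_E) x' ->
    cube (y0 + 2 ^+ j *: (x - y0)) (2 ^+ j * rho / 4) x' ->
    lam / 2 < `|singular_integral k (\1_E) x'|.
  move=> pvE x'Q.
  have pj : 1 <= 2 ^+ j :> R by rewrite exprn_ege1 // ler1n.
  have p0 : 0 < 2 ^+ j :> R by lra.
  have jr : 0 < 2 ^+ j * rho by exact: mulr_gt0.
  have x'E : `|x' - (y0 + 2 ^+ j *: (x - y0))| <= 2 ^+ j * rho / 8.
    by move/cubeE: x'Q => /(_ ltac:(lra)); lra.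
  have near y : E y -> `|x' - (y + 2 ^+ j *: (x - y))| <= 2 ^+ j * `|x - y| / 4.
    move=> /EQ Qy; have h1 := Q0near y Qy; have h2 := Q0low y Qy.
    have -> : x' - (y + 2 ^+ j *: (x - y)) =
        (x' - (y0 + 2 ^+ j *: (x - y0))) + (2 ^+ j - 1) *: (y - y0).
      by apply/rowP => i; rewrite !mxE; ring.
    apply: le_trans (ler_normD _ _) _; rewrite normrZ ger0_norm; last lra.
    have h3 : (2 ^+ j - 1) * `|y - y0| <= 2 ^+ j * (rho / 16).
      by apply: ler_pM => //; lra.
    have h4 : 2 ^+ j * (15 / 16 * rho) <= 2 ^+ j * `|x - y| by rewrite ler_wpM2l // ltW.
    by lra.
  have low y : E y -> C * (N1 ^+ n.+1)^-1 <= sg * k x' y.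
    move=> Ey; have Qy := EQ y Ey; have [_ Ey2] := Ey.
    have /andP[ey1 ey2] := Q0D y Qy.
    have ey0 : 0 < edist x y by lra.
    have exy : x != y by apply/eqP => xy; move: ey0; rewrite xy edistxx ltxx.
    have := farP x y x' j exy (near y Ey).
    have en0 : 0 < edist x y ^+ n.+1 by rewrite exprn_gt0.
    have h1 : 2 * C * (edist x y ^+ n.+1)^-1 < sg * k x y.
      by rewrite ltr_pdivrMr.
    have h2 : C * (N1 ^+ n.+1)^-1 <= C * (edist x y ^+ n.+1)^-1.
      rewrite ler_wpM2l ?(ltW C0) // lef_pV2 ?posrE ?exprn_gt0 //.
      by rewrite lerXn2r ?nnegrE ?(ltW ey0) ?(ltW N10) ?(ltW ey2).
    move: h1 h2; set A := (edist x y ^+ n.+1)^-1; set B := (N1 ^+ n.+1)^-1.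
    have -> : `|k x y - k x' y| = `|sg * k x y - sg * k x' y|.
      by rewrite -mulrBr normrM sg1 mul1r.
    by rewrite ler_norml => ? ? /andP[? ?]; lra.
  have [|e0 e00 [N0 appr]] := pv_approx pvE (_ : 0 < lam / 4); first lra.
  pose N2 := n.+1%:R * (`|x'| + `|y0| + rho).
  pose e := Num.min (e0 / 2) (rho / 4); pose N := Num.max N0 N2 + 1.
  have e_gt0 : 0 < e by rewrite lt_min; apply/andP; split; lra.
  have e_lt : e < e0 by rewrite gt_min; apply/orP; left; lra.
  have e_le : e <= rho / 4 by rewrite ge_min lexx orbT.
  have N_gt : N0 < N by rewrite /N (le_lt_trans (_ : N0 <= Num.max N0 N2)) ?le_max ?lexx // ltrDl.
  have N2_lt : N2 < N.
    by rewrite /N (le_lt_trans (_ : N2 <= Num.max N0 N2)) ?le_max ?lexx ?orbT // ltrDl.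
  have ED' : E `<=` annulus x' e N.
    move=> y Ey; have Qy := EQ y Ey; have := near y Ey.
    have h1 := Q0low y Qy; have h2 := Q0near y Qy => h3.
    apply/andP; split.
      apply: lt_le_trans (norm_le_edist _ _).
      have := ler_distD x' (y + 2 ^+ j *: (x - y)) y.
      rewrite [y + _ - y]addrAC subrr add0r normrZ ger0_norm ?(ltW p0) // distrC.
      have : `|x - y| <= 2 ^+ j * `|x - y| by rewrite ler_peMl.
      by lra.
    apply: le_lt_trans (edist_le_norm _ _) _; apply: le_lt_trans N2_lt.
    rewrite ler_wpM2l // -[x' - y](subrKA y0); apply: le_trans (ler_normD _ _) _.
    by apply: lerD; [exact: ler_normB|rewrite distrC; lra].
  have mD' : measurable (annulus x' e N : set X) by exact: measurable_annulus.
  have iE : mu.-integrable (annulus x' e N) (EFin \o (fun y : X => \1_E y : R)).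
    apply: (integrableS measurableT mD') => //.
    exact: integrable_indic_fin.
  have lam_le : lam <= sg * truncated k (\1_E) x' (e, N).
    rewrite /truncated /= -RintegralZl //; last exact: pvE.1.
    have -> : lam = (\int[mu]_(y in annulus x' e N) (C * (N1 ^+ n.+1)^-1 * \1_E y))%R.
      rewrite RintegralZl // /lam; congr (_ * _).
      by rewrite /m /Rintegral integral_indic // setIidl.
    apply: le_Rintegral => //.
    - exact: (integrable_scale (C * (N1 ^+ n.+1)^-1) mD' iE).
    - by apply: (integrable_scale sg mD'); exact: pvE.1.
    - move=> y _; rewrite mulrA indicE; case: (asboolP (E y)) => Ey.
        by rewrite mem_set // !mulr1; exact: low.
      by rewrite memNset // !mulr0.
  have h1 : lam <= `|truncated k (\1_E) x' (e, N)|.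
    by rewrite -[leRHS]mul1r -sg1 -normrM (le_trans lam_le) // ler_norm.
  have := appr e N; rewrite e_gt0 e_lt => /(_ isT N_gt).
  rewrite distrC => h2.
  have := ler_normB (singular_integral k (\1_E) x' - truncated k (\1_E) x' (e, N))
    (singular_integral k (\1_E) x').
  by rewrite addrAC subrr sub0r normrN; lra.
have [c W] := T_weak.
have := W (\1_E) (indic_in_Lr mE Efin) (lam / 2) ltac:(lra).
rewrite LnormX // integral_indic_powR // -mEE -EFinM.
set P := (lam / 2) `^ r; have P0 : 0 < P by apply: powR_gt0; lra.
move=> WE.
have big (j : nat) : P * (2 ^+ j * (rho / 4) ^+ n.+1) <= c * m.
  rewrite -lee_fin; apply: le_trans WE; rewrite EFinM lee_pmul2l ?lte_fin //.
  have pj : 1 <= 2 ^+ j :> R by rewrite exprn_ege1 // ler1n.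
  have l0 : 0 < 2 ^+ j * rho / 4 by rewrite -mulrA mulr_gt0 //; lra.
  apply: le_trans (measure_ae_le (T_on_Lr (indic_in_Lr mE Efin)).2 (key j)).
  apply: le_trans (leb_cube_ge _ l0); rewrite lee_fin -mulrA [leRHS]exprMn.
  rewrite ler_wpM2r //; first by apply: exprn_ge0; lra.
  by rewrite exprS ler_peMr ?exprn_ege1 //; lra.
pose u := P * (rho / 4) ^+ n.+1.
have u0 : 0 < u by rewrite mulr_gt0 // exprn_gt0 //; lra.
pose j := (Num.trunc (c * m / u)).+1.
have := big j; rewrite mulrCA -/u -ler_pdivlMr // leNgt => /negP; apply.
apply: lt_trans (truncnS_gt _) _.
by rewrite -natrX ltr_nat ltn_expl.
Qed.

Lemma rat_vector_dense z (d : R) : 0 < d ->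
  exists q : 'rV[rat]_n.+1, `|z - map_mx ratr q| <= d.
Proof.
move=> d0.
have H i : exists q : rat, `|z 0 i - ratr q| <= d.
  have /rat_in_itvoo [q] : z 0 i - d < z 0 i + d by lra.
  by rewrite in_itv /= => /andP[? ?]; exists q; rewrite ler_norml; lra.
have [q qP] := choice H.
by exists (\row_i q i); apply/norm_leP => [|i]; [exact: ltW|rewrite !mxE; exact: qP].
Qed.

(** Regularity determines the kernel only up to a function of its second
variable, which the weak-type inequality forces to vanish almost everywhere. The
points z <> x are covered by countably many cubes, with rational centres, to
which [kernel_large_null] applies. *)
Lemma ae_kernel_size : exists2 C : R, 0 < C & \forall x \ae mu,
  (forall e N, 0 < e -> mu.-integrable (annulus x e N) (fun y => (k x y)%:E)) /\
  \forall z \ae mu, z != x -> `|k x z| <= C * (edist x z ^+ n.+1)^-1.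
Proof.
have [C C0 farP] := kernel_far_diff_le omega_nd hk.
exists (2 * C); first by rewrite mulr_gt0.
apply: ae_imp ae_kernel_integrable => x Ik; split => //.
pose q (j : nat) : Rn := map_mx ratr (odflt 0 (unpickle j : option 'rV[rat]_n.+1)).
pose F (j : nat) (sg : R) : set Rn := if x == q j then set0 else
  [set y | cube (q j) (`|x - q j| / 8) y /\ 2 * C < sg * k x y * edist x y ^+ n.+1].
have F0 j sg : `|sg| = 1 -> mu.-negligible (F j sg).
  move=> sg1; rewrite /F; case: eqP => [_|/eqP xq]; first exact: negligible_set0.
  exact: kernel_large_null.
have : mu.-negligible (\bigcup_j (F j 1 `|` F j (-1))).
  apply: negligible_bigcup => j; apply: negligibleU; apply: F0.
    exact: normr1.
  exact: normrN1.
apply: negligibleS => z /= /not_implyP [zx /negP]; rewrite -ltNge => kz.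
have d0 : 0 < `|x - z| / 32 by rewrite divr_gt0 // normr_gt0 subr_eq0 eq_sym.
have [p pz] := rat_vector_dense z d0.
exists (pickle p) => //; have qE : q (pickle p) = map_mx ratr p by rewrite /q pickleK.
have h1 := ler_distD (map_mx ratr p) x z; rewrite (distrC (map_mx ratr p) z) in h1.
have xp : x != q (pickle p).
  by rewrite qE -subr_eq0 -normr_gt0; lra.
have zQ : cube (q (pickle p)) (`|x - q (pickle p)| / 8) z.
  by apply/cubeE; rewrite qE //; lra.
have ez : 0 < edist x z ^+ n.+1 by rewrite exprn_gt0 // edist_gt0 // eq_sym.
have kz' : 2 * C < `|k x z| * edist x z ^+ n.+1 by rewrite -ltr_pdivrMr.
have [k0|k0] := leP 0 (k x z).
  by left; rewrite /F (negPf xp); split => //; rewrite mul1r -(ger0_norm k0).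
by right; rewrite /F (negPf xp); split => //; rewrite mulN1r -(ltr0_norm k0).
Qed.

End calderon_zygmund_size.

(** * Dyadic form of the Dini conditions *)

Section dini.
Context {R : realType}.

Lemma dyadic_sum_le_integral (psi : R -> R) (v : nat -> R) :
  measurable_fun (`]0, 1[ : set R) psi -> (forall t, 0 < t < 1 -> 0 <= psi t) ->
  (forall j t, (2 ^+ j.+1)^-1 < t < (2 ^+ j)^-1 -> v j <= psi t) ->
  (forall j, 0 <= v j) -> forall J,
  ((\sum_(j < J) v j * (2 ^+ j.+1)^-1)%:E <=
    \int[@lebesgue_measure R]_(t in `]0%R, 1%R[) (psi t)%:E)%E.
Proof.
move=> mpsi psi0 vpsi v0.
have p0 j : 0 < (2 ^+ j)^-1 :> R by rewrite invr_gt0 exprn_gt0.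
have p1 j : (2 ^+ j)^-1 <= 1 :> R by rewrite invf_le1 ?exprn_gt0 // exprn_ege1 // ler1n.
have pS j : (2 ^+ j.+1)^-1 = (2 ^+ j)^-1 / 2 :> R by rewrite exprS invfM mulrC.
pose I (a b : R) : set R := `]a, b[%classic.
have IP (a b t : R) : I a b t -> a < t < b by rewrite /I /= in_itv.
have PI (a b t : R) : a < t < b -> I a b t by rewrite /I /= in_itv.
have mI (a b : R) : measurable (I a b) by exact: measurable_itv.
have sub01 (a b : R) : 0 <= a -> b <= 1 -> I a b `<=` I 0 1.
  by move=> a0 b1 t /IP/andP[? ?]; apply/PI/andP; split; lra.
have meas (a b : R) : 0 <= a -> b <= 1 -> measurable_fun (I a b) (EFin \o psi).
  move=> a0 b1; apply/measurable_EFinP; apply: measurable_funS mpsi => //.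
  exact: sub01.
have pos (a b : R) : 0 <= a -> b <= 1 -> forall t, I a b t -> (0 <= (psi t)%:E)%E.
  by move=> a0 b1 t /(sub01 _ _ a0 b1)/IP; rewrite lee_fin; exact: psi0.
pose p (j : nat) : R := (2 ^+ j)^-1.
suff H J : ((\sum_(j < J) v j * p j.+1)%:E <=
    \int[@lebesgue_measure R]_(t in I (p J) 1%R) (psi t)%:E)%E.
  move=> J; apply: le_trans (H J) _; apply: ge0_subset_integral.
  - exact: mI.
  - exact: mI.
  - by apply: (meas 0 1).
  - by apply: (pos 0 1).
  - by apply: sub01 => //; exact: ltW (p0 J).
elim: J => [|J IH].
  by rewrite big_ord0; apply: integral_ge0; apply: pos => //; exact: ltW (p0 0%N).
have pJ := pS J; have pJ0 := p0 J; have pJ1 := p1 J; have pJ0' := p0 J.+1.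
rewrite -/(p J) -/(p J.+1) in pJ pJ0 pJ1 pJ0'.
have dis : [disjoint I (p J.+1) (p J) & I (p J) 1].
  apply/disj_set2P; apply/seteqP; split => // t [].
  by move=> /IP/andP[_ h1] /IP/andP[h2 _]; have := lt_trans h1 h2; rewrite ltxx.
apply: (@le_trans _ _ (\int[@lebesgue_measure R]_(t in
    I (p J.+1) (p J) `|` I (p J) 1%R) (psi t)%:E)%E); last first.
  apply: ge0_subset_integral.
  - by apply: measurableU; exact: mI.
  - exact: mI.
  - by apply: meas => //; exact: ltW.
  - by apply: pos => //; exact: ltW.
  - by clear IH; move=> t [] /IP/andP[? ?]; apply/PI/andP; split; lra.
rewrite ge0_integral_setU; [|exact: mI|exact: mI| | |exact: dis]; first last.
- by move=> t [] H; apply: pos H => //; exact: ltW.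
- by apply/measurable_funU; [exact: mI|exact: mI|split; apply: meas => //; exact: ltW].
rewrite big_ord_recr /= addrC EFinD; apply: leeD => //.
apply: (@le_trans _ _ (\int[@lebesgue_measure R]_(t in I (p J.+1) (p J)) (v J)%:E)%E).
  rewrite integral_cst; last exact: mI.
  rewrite /= lebesgue_measure_itv /= lte_fin ifT; last by clear IH; lra.
  rewrite -EFinB -EFinM lee_fin ler_wpM2l //; clear IH; lra.
apply: ge0_le_integral.
- exact: mI.
- by move=> t _; rewrite lee_fin.
- exact: measurable_cst.
- by apply: meas => //; exact: ltW.
- by move=> t /IP; rewrite lee_fin; exact: vpsi.
Qed.

Lemma nondecreasing_measurable_itv01 (f : R -> R) :
  (forall t u, 0 < t -> t <= u -> u < 1 -> f t <= f u) ->
  measurable_fun (`]0, 1[ : set R) f.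
Proof.
move=> f_nd.
apply: (measurability (@RGenCInfty.G R)) => [|/= _ [_] [a] -> <-].
  exact: RGenCInfty.measurableE.
apply: is_interval_measurable => s t /=.
rewrite !in_itv /= !andbT => -[/andP[s0 s1] fs] [/andP[t0 t1] ft] u /andP[su ut].
split; first by rewrite in_itv /= (lt_le_trans s0 su) (le_lt_trans ut t1).
by rewrite in_itv /= andbT (le_trans fs) // f_nd // (le_lt_trans ut t1).
Qed.

Lemma nonincreasing_measurable_itv01 (f : R -> R) :
  (forall t u, 0 < t -> t <= u -> u < 1 -> f u <= f t) ->
  measurable_fun (`]0, 1[ : set R) f.
Proof.
move=> f_ni; rewrite -(opprK f); apply/measurable_funN.
by apply: nondecreasing_measurable_itv01 => t u t0 tu u1; rewrite lerN2 f_ni.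
Qed.

Context (n : nat) (cn : R) (omega : R -> R) (hcn : dim_const n cn)
  (omega_nd : forall t u : R, 0 < t -> t <= u -> omega t <= omega u)
  (omega0 : forall t, 0 < t -> 0 <= omega t).

Lemma dim_const_gt0 : 0 < cn.
Proof.
pose x : 'rV[R]_n.+1 := const_mx (1 / 4); pose y : 'rV[R]_n.+1 := const_mx 2.
have h1 : 0 < edist 0 x.
  by apply: edist_gt0; apply/eqP => /rowP /(_ ord0); rewrite !mxE; lra.
have h2 : 0 < edist 0 y.
  by apply: edist_gt0; apply/eqP => /rowP /(_ ord0); rewrite !mxE; lra.
have := hcn (a := 0) ltr01 (leqnn 1) (x := 0) (x' := x) (y := y).
move=> /(_ _ _ _)/(lt_le_trans (divr_gt0 h1 h2)) H.
have : 0 < cn * 2 ^- 1.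
  apply: H => [i|i|/(_ ord0)]; rewrite !mxE ?subrr ?normr0 ?subr0 ?ger0_norm; lra.
by rewrite pmulr_lgt0 // invr_gt0 exprn_gt0.
Qed.

Lemma measurable_omega_scaled : measurable_fun (`]0, 1[ : set R) (fun t => omega (cn * t)).
Proof.
have cn0 := dim_const_gt0.
apply: nondecreasing_measurable_itv01 => t u t0 tu _.
by apply: omega_nd; rewrite ?mulr_gt0 // ler_wpM2l // ltW.
Qed.

Lemma measurable_inv01 : measurable_fun (`]0, 1[ : set R) (fun t => t^-1).
Proof.
apply: nonincreasing_measurable_itv01 => t u t0 tu _.
by rewrite lef_pV2 // posrE (lt_le_trans t0 tu).
Qed.

(** On the dyadic interval from 2^-(j+1) to 2^-j the integrand is at least
omega (cn 2^-(j+1)) 2^j, so the interval contributes half of a term of the sum. *)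
Lemma dini_sum_bounded :
  (\int[@lebesgue_measure R]_(t in `]0%R, 1%R[) (omega (cn * t) / t)%:E < +oo)%E ->
  exists W, forall J, \sum_(j < J) omega (cn * (2 ^+ j.+1)^-1) <= W.
Proof.
move=> Ifin; have cn0 := dim_const_gt0.
have p0 j : 0 < (2 ^+ j)^-1 :> R by rewrite invr_gt0 exprn_gt0.
have o0 j : 0 <= omega (cn * (2 ^+ j.+1)^-1) by rewrite omega0 // mulr_gt0.
set I := (X in (X < +oo)%E) in Ifin.
have : forall J, ((\sum_(j < J) (omega (cn * (2 ^+ j.+1)^-1) * 2 ^+ j) * (2 ^+ j.+1)^-1)%:E <= I)%E.
  apply: (@dyadic_sum_le_integral (fun t => omega (cn * t) / t)
    (fun j => omega (cn * (2 ^+ j.+1)^-1) * 2 ^+ j)).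
  - by apply: measurable_funM; [exact: measurable_omega_scaled|exact: measurable_inv01].
  - by move=> t /andP[t0 _]; rewrite divr_ge0 ?omega0 ?mulr_gt0 // ltW.
  - move=> j t /andP[t1 t2]; have t0 : 0 < t by apply: lt_trans t1.
    apply: ler_pM => //.
      by apply: omega_nd; rewrite ?mulr_gt0 // ler_wpM2l ?(ltW cn0) ?(ltW t1).
    by rewrite -[leLHS]invrK lef_pV2 ?posrE // ltW.
  - by move=> j; rewrite mulr_ge0 ?exprn_ge0.
move=> H; exists (2 * fine I) => J.
have I0 : (0 <= I)%E by apply: le_trans (H 0%N); rewrite big_ord0.
have := H J; rewrite -[I]fineK ?ge0_fin_numE // lee_fin => HJ.
rewrite -ler_pdivrMl // mulr_sumr; apply: le_trans HJ; apply: ler_sum => j _.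
rewrite le_eqVlt; apply/orP; left; apply/eqP; rewrite exprS.
have pj : 2 ^+ j != 0 :> R by rewrite expf_neq0.
by field; rewrite pj.
Qed.

(** As for [dini_sum_bounded]; on the j-th interval ln (1 / t) >= j ln 2. *)
Lemma dini_log_sum_bounded :
  (\int[@lebesgue_measure R]_(t in `]0%R, 1%R[)
    (omega (cn * t) * ln t^-1 / t)%:E < +oo)%E ->
  exists W, forall J, \sum_(j < J) omega (cn * (2 ^+ j.+1)^-1) * j%:R <= W.
Proof.
move=> Ifin; have cn0 := dim_const_gt0.
have p0 j : 0 < (2 ^+ j)^-1 :> R by rewrite invr_gt0 exprn_gt0.
have o0 j : 0 <= omega (cn * (2 ^+ j.+1)^-1) by rewrite omega0 // mulr_gt0.
have l2 : 0 < ln 2 :> R by rewrite ln_gt0 // ltr1n.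
set I := (X in (X < +oo)%E) in Ifin.
have : forall J, ((\sum_(j < J) (omega (cn * (2 ^+ j.+1)^-1) * (j%:R * ln 2) * 2 ^+ j)
    * (2 ^+ j.+1)^-1)%:E <= I)%E.
  apply: (@dyadic_sum_le_integral (fun t => omega (cn * t) * ln t^-1 / t)
    (fun j => omega (cn * (2 ^+ j.+1)^-1) * (j%:R * ln 2) * 2 ^+ j)).
  - apply: measurable_funM; last exact: measurable_inv01.
    apply: measurable_funM; first exact: measurable_omega_scaled.
    apply: nonincreasing_measurable_itv01 => t u t0 tu _.
    have u0 := lt_le_trans t0 tu.
    by rewrite ler_ln ?posrE ?invr_gt0 // lef_pV2.
  - move=> t /andP[t0 t1]; rewrite divr_ge0 ?(ltW t0) // mulr_ge0 ?omega0 ?mulr_gt0 //.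
    by rewrite ln_ge0 // invf_ge1 // ltW.
  - move=> j t /andP[t1 t2]; have t0 : 0 < t by apply: lt_trans t1.
    have t3 : 2 ^+ j <= t^-1 by rewrite -[leLHS]invrK lef_pV2 ?posrE // ltW.
    have jl : 0 <= j%:R * ln 2 :> R by rewrite mulr_ge0 // ltW.
    apply: ler_pM => //; first by rewrite mulr_ge0.
    apply: ler_pM => //.
      by apply: omega_nd; rewrite ?mulr_gt0 // ler_wpM2l ?(ltW cn0) ?(ltW t1).
    rewrite mulr_natl -lnXn // ler_ln ?posrE ?exprn_gt0 ?invr_gt0 //.
  - by move=> j; rewrite mulr_ge0 ?exprn_ge0 // mulr_ge0 // mulr_ge0 // ltW.
move=> H; exists (2 / ln 2 * fine I) => J.
have I0 : (0 <= I)%E by apply: le_trans (H 0%N); rewrite big_ord0.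
have := H J; rewrite -[I]fineK ?ge0_fin_numE // lee_fin => HJ.
have c0 : 0 < 2 / ln 2 :> R by rewrite divr_gt0.
rewrite -ler_pdivrMl // mulr_sumr; apply: le_trans HJ; apply: ler_sum => j _.
rewrite le_eqVlt; apply/orP; left; apply/eqP; rewrite exprS.
have pj : 2 ^+ j != 0 :> R by rewrite expf_neq0.
by field; rewrite pj (gt_eqF l2).
Qed.

End dini.

(** * Contribution of the points far from a cube *)

Section tail.
Context {R : realType} {n : nat}.
Local Notation Rn := 'rV[R]_n.+1.
Local Notation X := (caratheodory_type (@leb_outer R n)).
Local Notation mu := (@leb R n).
Implicit Types (x y z a : Rn) (g : Rn -> R).

Lemma integral_indicM (A : set Rn) (phi : X -> R) :
  (\int[mu]_z (\1_A z * phi z)%:E = \int[mu]_(z in A) (phi z)%:E)%E.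
Proof.
rewrite [RHS]integral_mkcond; apply: eq_integral => z _.
by rewrite patchE indicE; case: ifP => zA; rewrite ?mul1r ?mul0r.
Qed.

Lemma integral_combination_le (J : nat) (b v : nat -> R) (phi : nat -> X -> R) :
  (forall i, 0 <= v i) -> (forall i z, 0 <= phi i z) ->
  (forall i, measurable_fun setT (phi i)) ->
  (forall i, (\int[mu]_z (phi i z)%:E <= (b i)%:E)%E) ->
  (\int[mu]_z (\sum_(i < J) v i * phi i z)%:E <= (\sum_(i < J) v i * b i)%:E)%E.
Proof.
move=> v0 p0 mp pb; under eq_integral do rewrite -sumEFin.
have mv i : measurable_fun setT (EFin \o (fun z : X => v i * phi i z)).
  apply/measurable_EFinP; apply: measurable_funM; [exact: measurable_cst|exact: mp].
have vp i z : [set: X] z -> (0 <= (v i * phi i z)%:E)%E.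
  by move=> _; rewrite lee_fin mulr_ge0.
rewrite ge0_integral_sum; [|exact: measurableT|by move=> i; exact: mv|by move=> i z; exact: vp].
rewrite -sumEFin; apply: lee_sum => i _; under eq_integral do rewrite EFinM.
rewrite ge0_integralZl_EFin; first by rewrite EFinM lee_wpmul2l // lee_fin.
- exact: measurableT.
- by move=> z _; rewrite lee_fin.
- by apply/measurable_EFinP; exact: mp.
- exact: v0.
Qed.

Definition shell x (s t : R) : set Rn := [set z | s <= edist x z < t].

Lemma measurable_shell x (s t : R) : measurable (shell x s t : set X).
Proof.
have -> : (shell x s t : set X) = [set: X] `&` (fun z : X => edist x z) @^-1` `[s, t[.
  by rewrite setTI; apply/seteqP; split => z; rewrite /shell /= in_itv.
exact: measurable_edist.
Qed.

Lemma sum_shell_integral (phi : X -> R) x (s t : R) (K : nat) :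
  0 <= t -> measurable_fun setT phi -> (forall z, 0 <= phi z) ->
  (\sum_(i < K) \int[mu]_(z in shell x (s + t *+ i) (s + t *+ i.+1)) (phi z)%:E =
   \int[mu]_(z in shell x s (s + t *+ K)) (phi z)%:E)%E.
Proof.
move=> t0 mphi phi0.
elim: K => [|K IH].
  rewrite big_ord0 mulr0n addr0 (_ : shell x s s = set0) ?integral_set0 //.
  by apply/seteqP; split => // z /andP[h1 /(le_lt_trans h1)]; rewrite ltxx.
rewrite big_ord_recr /= IH -ge0_integral_setU.
- congr (integral _ _ _); apply/seteqP; split => z; rewrite /shell /=.
    move=> [] /andP[h1 h2]; apply/andP; split => //.
      by apply: lt_le_trans h2 _; rewrite lerD2l mulrSr lerDl.
    by apply: le_trans h1; rewrite lerDl mulrn_wge0.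
  move=> /andP[h1 h2]; have [h|h] := ltP (edist x z) (s + t *+ K); [left|right];
    by apply/andP.
- exact: measurable_shell.
- exact: measurable_shell.
- by apply/measurable_EFinP; apply: measurable_funTS.
- by move=> z _; rewrite lee_fin.
- apply/disj_set2P; apply/seteqP; split => // z [] /andP[_ h1] /andP[h2 _].
  by have := lt_le_trans h1 h2; rewrite ltxx.
Qed.

Lemma exists_light_shell (phi : X -> R) x (s t b : R) (K : nat) :
  0 <= t -> (0 < K)%N -> measurable_fun setT phi -> (forall z, 0 <= phi z) ->
  (\int[mu]_(z in shell x s (s + t *+ K)) (phi z)%:E <= b%:E)%E ->
  exists2 i, (i < K)%N &
  (\int[mu]_(z in shell x (s + t *+ i) (s + t *+ i.+1)) (phi z)%:E <= (b / K%:R)%:E)%E.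
Proof.
move=> t0 K0 mphi phi0; rewrite -sum_shell_integral // => sb.
apply: contrapT => nex.
have lt i : (i < K)%N -> ((b / K%:R)%:E <
    \int[mu]_(z in shell x (s + t *+ i) (s + t *+ i.+1)) (phi z)%:E)%E.
  by move=> iK; rewrite ltNge; apply/negP => h; apply: nex; exists i.
have H m : (m < K)%N -> (\sum_(i < m.+1) (b / K%:R)%:E < \sum_(i < m.+1)
    \int[mu]_(z in shell x (s + t *+ i) (s + t *+ i.+1)) (phi z)%:E)%E.
  elim: m => [|m IH] mK; first by rewrite !big_ord1; exact: lt.
  rewrite big_ord_recr [X in (_ < X)%E]big_ord_recr /=.
  by apply: lteD; [apply: IH; exact: ltnW|exact: lt].
have := H K.-1; rewrite prednK // => /(_ (leqnn _))/lt_le_trans/(_ sb).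
rewrite sumEFin sumr_const card_ord -[X in (X%:E < _)%E]mulr_natr divfK ?ltxx //.
by rewrite pnatr_eq0 -lt0n.
Qed.

Context (k : Rn -> Rn -> R) (omega : R -> R) (cn : R)
  (omega_nd : forall t u : R, 0 < t -> t <= u -> omega t <= omega u)
  (hk : kernel_regularity k omega) (hcn : dim_const n cn).

Let cn0 : 0 < cn := dim_const_gt0 hcn.

Let omega_p0 i : 0 <= omega (cn * (2 ^+ i)^-1).
Proof. by apply: (omega_ge0 omega_nd hk); rewrite mulr_gt0 // invr_gt0 exprn_gt0. Qed.

(** The dimensional constant cn enters here: outside 2^j Q the ratio of distances
in the regularity condition is at most cn 2^-j. *)
Lemma kernel_diff_annulus : exists2 c : R, 0 < c &
  forall a l x x' z (j : nat), 0 < l -> cube a l x -> cube a l x' ->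
    (0 < j)%N -> ~ cube a (2 ^+ j * l) z ->
  `|k x z - k x' z| <= c * ((2 ^+ j * l / 4) ^+ n.+1)^-1 * omega (cn * (2 ^+ j)^-1).
Proof.
have [c c0 H] := hk; exists c => // a l x x' z j l0 xQ x'Q j0 zQ.
have pj : 2 <= 2 ^+ j :> R by rewrite -[leLHS]expr1 ler_eXn2l // ltr1n.
have jl : 2 * l <= 2 ^+ j * l by rewrite ler_wpM2r // ltW.
have jl0 : 0 < 2 ^+ j * l / 4 by lra.
have [->|ne] := eqVneq x x'.
  by rewrite subrr normr0 !mulr_ge0 ?(ltW c0) // invr_ge0 exprn_ge0 // ltW.
have zQ2 : ~ cube a (2 * l) z.
  by move=> h; apply: zQ => i; apply: le_trans (h i) _; lra.
have xz : 2 ^+ j * l / 4 <= edist x z.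
  apply: le_trans (norm_le_edist x z).
  have : 2 ^+ j * l / 2 < `|z - a|.
    by rewrite ltNge; apply/negP => h; apply: zQ; apply/cubeE => //; lra.
  have : `|x - a| <= l / 2 by apply/cubeE => //; exact: ltW.
  by have := ler_distD x z a; rewrite (distrC z x); lra.
have xz0 : 0 < edist x z by apply: lt_le_trans xz.
have ratio : edist x x' / edist x z <= cn * (2 ^+ j)^-1.
  exact: (hcn l0 j0 xQ x'Q zQ).
apply: le_trans (H a l l0 x x' z xQ x'Q ne zQ2) _.
apply: ler_pM.
- by rewrite mulr_ge0 ?(ltW c0) // invr_ge0 exprn_ge0 // ltW.
- by apply: (omega_ge0 omega_nd hk); rewrite divr_gt0 // edist_gt0.
- rewrite ler_wpM2l ?(ltW c0) // lef_pV2 ?posrE ?exprn_gt0 //.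
  by rewrite lerXn2r ?nnegrE // ltW.
- by apply: omega_nd => //; rewrite divr_gt0 // edist_gt0.
Qed.

Definition annulus_coef (c l : R) (i : nat) : R :=
  c * ((2 ^+ i.+1 * l / 4) ^+ n.+1)^-1 * omega (cn * (2 ^+ i.+1)^-1).

Lemma annulus_coef_ge0 c l i : 0 < c -> 0 < l -> 0 <= annulus_coef c l i.
Proof.
move=> c0 l0; have p0 : 0 < 2 ^+ i.+1 :> R by rewrite exprn_gt0.
by rewrite mulr_ge0 // mulr_ge0 ?(ltW c0) // invr_ge0 exprn_ge0 // !mulr_ge0 // ltW.
Qed.

Lemma cube_scale_sub a l (i j : nat) : 0 < l -> (i <= j)%N ->
  cube a (2 ^+ i * l) `<=` cube a (2 ^+ j * l).
Proof.
move=> l0 ij z zi m; apply: le_trans (zi m) _; rewrite ler_pM2r ?invr_gt0 //.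
by rewrite ler_wpM2r ?(ltW l0) // ler_eXn2l // ltr1n.
Qed.

(** The point z lies in some 2^(i+2) Q but not in 2^(i+1) Q, and the term of that i
is enough. *)
Lemma kernel_diff_sum (c : R) a l x x' z (J : nat) : 0 < c -> 0 < l ->
  (forall j, (0 < j)%N -> ~ cube a (2 ^+ j * l) z ->
    `|k x z - k x' z| <= c * ((2 ^+ j * l / 4) ^+ n.+1)^-1 * omega (cn * (2 ^+ j)^-1)) ->
  ~ cube a (2 * l) z -> cube a (2 ^+ J.+1 * l) z ->
  `|k x z - k x' z| <= \sum_(i < J) annulus_coef c l i * \1_(cube a (2 ^+ i.+2 * l)) z.
Proof.
move=> c0 l0 H z2; elim: J => [|J IH] zJ; first by rewrite expr1 in zJ.
rewrite big_ord_recr /=.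
have [zJ'|zJ'] := pselect (cube a (2 ^+ J.+1 * l) z).
  apply: le_trans (IH zJ') _; rewrite lerDl mulr_ge0 ?annulus_coef_ge0 //.
rewrite [X in _ + _ * X]indicE mem_set // mulr1.
apply: le_trans (H _ _ zJ') _ => //; rewrite lerDr.
by apply: sumr_ge0 => i _; rewrite mulr_ge0 ?annulus_coef_ge0.
Qed.

(** The exponent n + 4 is such that 2^n bounds the dimension n + 1 and 2^4 the
numerical constants. *)
Lemma ball_sub_cube a l x z (t : R) (m : nat) : 0 < l -> cube a l x ->
  edist x z < t -> t <= 3 * 2 ^+ m * (n.+1%:R * l) ->
  cube a (2 ^+ (m + (n + 4)) * l) z.
Proof.
move=> l0 xQ xz tm; apply/cubeE; first by rewrite mulr_ge0 ?exprn_ge0 // ltW.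
have h1 : `|x - a| <= l / 2 by apply/cubeE => //; exact: ltW.
have h2 := norm_le_edist x z; have h3 := ler_distD x z a.
rewrite (distrC z x) in h3.
have pm : 1 <= 2 ^+ m :> R by rewrite exprn_ege1 // ler1n.
have nn : n.+1%:R <= 2 ^+ n :> R by rewrite -natrX ler_nat ltn_expl.
have n1 : 1 <= n.+1%:R :> R by rewrite ler1n.
have h4 : 2 ^+ m * (n.+1%:R * l) <= 2 ^+ m * (2 ^+ n * l).
  by rewrite ler_wpM2l ?exprn_ge0 // ler_wpM2r // ltW.
have h5 : l <= 2 ^+ m * (n.+1%:R * l).
  by rewrite mulrA ler_peMl ?(ltW l0) // mulr_ege1.
rewrite !exprD (_ : 2 ^+ 4 = 16 :> R); last by ring.
rewrite [leRHS](_ : _ = 8 * (2 ^+ m * (2 ^+ n * l))); last by field.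
lra.
Qed.

(** Regularity bounds |k x z - k x' z| |g z| by the sum where both truncations keep
z; for z in the shell S, which one truncation may keep and the other not, the
second term is the size of the kernel at distance s times |g z|. *)
Definition majorant (c C s : R) a l g (J : nat) (S : set Rn) z : R :=
  \sum_(i < J) annulus_coef c l i * (\1_(cube a (2 ^+ i.+2 * l)) z * `|g z|) +
  C * (s ^+ n.+1)^-1 * (\1_S z * `|g z|).
Arguments majorant : clear implicits.

Lemma majorant_sum_ge0 (c : R) a l g (J : nat) z : 0 < c -> 0 < l ->
  0 <= \sum_(i < J) annulus_coef c l i * (\1_(cube a (2 ^+ i.+2 * l)) z * `|g z|).
Proof.
by move=> c0 l0; apply: sumr_ge0 => i _; rewrite mulr_ge0 ?annulus_coef_ge0 // mulr_ge0.
Qed.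

Lemma majorant_size_ge0 (C s : R) g (S : set Rn) z : 0 < C -> 0 < s ->
  0 <= C * (s ^+ n.+1)^-1 * (\1_S z * `|g z|).
Proof.
by move=> C0 s0; rewrite !mulr_ge0 ?(ltW C0) // invr_ge0 exprn_ge0 // ltW.
Qed.

(** The truncations of the integrals about x and x' at the radius N disagree on
keeping z only when z lies at distance about N from x. *)
Lemma truncation_diff_le (c C s d N : R) (J : nat) a l x x' g z :
  0 < c -> 0 < C -> 0 < l -> 0 < s ->
  (forall j, (0 < j)%N -> ~ cube a (2 ^+ j * l) z ->
    `|k x z - k x' z| <= c * ((2 ^+ j * l / 4) ^+ n.+1)^-1 * omega (cn * (2 ^+ j)^-1)) ->
  ~ cube a (2 * l) z -> `|edist x z - edist x' z| <= d -> s <= N - d ->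
  (edist x z < N -> cube a (2 ^+ J.+1 * l) z) ->
  `|k x z| <= C * (edist x z ^+ n.+1)^-1 -> `|k x' z| <= C * (edist x' z ^+ n.+1)^-1 ->
  `|(if edist x z < N then k x z * g z else 0) -
    (if edist x' z < N then k x' z * g z else 0)| <=
  majorant c C s a l g J (shell x (N - d) (N + d)) z.
Proof.
move=> c0 C0 l0 s0 Hk z2 lip sN zJ kx kx'.
have d0 : 0 <= d by apply: le_trans lip.
have [lip1 lip2] : edist x' z - d <= edist x z /\ edist x z - d <= edist x' z.
  by move: lip; rewrite ler_norml => /andP[? ?]; split; lra.
have sum0 := majorant_sum_ge0 a g J z c0 l0.
have size0 := majorant_size_ge0 g (shell x (N - d) (N + d)) z C0 s0.
have size y : `|k y z| <= C * (edist y z ^+ n.+1)^-1 -> s <= edist y z ->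
    `|k y z * g z| <= C * (s ^+ n.+1)^-1 * `|g z|.
  move=> ky sy; rewrite normrM ler_wpM2r //; apply: le_trans ky _.
  rewrite ler_wpM2l ?(ltW C0) // lef_pV2 ?posrE ?exprn_gt0 ?(lt_le_trans s0 sy) //.
  by rewrite lerXn2r ?nnegrE ?(ltW s0) ?edist_ge0.
have inS : N - d <= edist x z < N + d ->
    \1_(shell x (N - d) (N + d)) z * `|g z| = `|g z|.
  by move=> zS; rewrite indicE mem_set ?mul1r.
rewrite /majorant.
case: (ltP (edist x z) N) => A; case: (ltP (edist x' z) N) => A'.
- rewrite -mulrBl normrM; apply: (@le_trans _ _ (\sum_(i < J) annulus_coef c l i *
      (\1_(cube a (2 ^+ i.+2 * l)) z * `|g z|))); last by rewrite lerDl.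
  under eq_bigr do rewrite mulrA.
  by rewrite -mulr_suml ler_wpM2r //; apply: kernel_diff_sum => //; exact: zJ.
- rewrite subr0 inS; last by move: A A' lip2 d0; move=> *; apply/andP; split; lra.
  apply: le_trans (size x kx _) _; last by rewrite lerDr.
  by move: A' lip2 sN; lra.
- rewrite sub0r normrN inS; last by move: A A' lip1 d0; move=> *; apply/andP; split; lra.
  apply: le_trans (size x' kx' _) _; last by rewrite lerDr.
  by move: A lip2 sN; lra.
- by rewrite subrr normr0 addr_ge0.
Qed.

Lemma measurable_majorant (c C s : R) a l g (J : nat) (S : set Rn) :
  Lebesgue_measurable g -> measurable (S : set X) ->
  measurable_fun [set: X] (majorant c C s a l g J S : X -> R).
Proof.
move=> mg mS.
have mabs := measurable_absr mg.
have mA (A : set X) : measurable A -> measurable_fun [set: X] (fun z : X => \1_A z * `|g z| : R).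
  by move=> ?; apply: measurable_funM; [exact: measurable_indic|exact: mabs].
apply: measurable_funD.
  apply: measurable_sum => i; apply: measurable_funM; first exact: measurable_cst.
  by apply: mA; exact: measurable_cube.
by apply: measurable_funM; [exact: measurable_cst|exact: mA].
Qed.

(** The factor 8 compares the side of 2^(i+2) Q with the lower bound
2^(i+1) l / 4 for the distance to the points outside 2^(i+1) Q. *)
Lemma annulus_coefM (c l b : R) i : 0 < l ->
  annulus_coef c l i * ((2 ^+ i.+2 * l) ^+ n.+1 * b) =
  c * 8 ^+ n.+1 * (omega (cn * (2 ^+ i.+1)^-1) * b).
Proof.
move=> l0; have q0 : 2 ^+ i.+1 * l / 4 != 0.
  by rewrite !mulf_neq0 ?invr_neq0 ?expf_neq0 ?gt_eqF.
rewrite /annulus_coef (_ : 2 ^+ i.+2 * l = 8 * (2 ^+ i.+1 * l / 4)); last first.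
  by rewrite (exprS _ i.+1); field.
move: (2 ^+ i.+1 * l / 4) q0 => q q0; have := expf_neq0 n.+1 q0.
rewrite [(8 * q) ^+ _]exprMn; move: (omega _) (8 ^+ n.+1) (q ^+ n.+1) => o e Q Q0.
by field.
Qed.

Lemma integral_majorant_le (c C s B b : R) a l g (J : nat) (S : set Rn) (w : nat -> R) (W : R) :
  0 < c -> 0 < C -> 0 < l -> 0 < s -> 0 <= B ->
  Lebesgue_measurable g -> measurable (S : set X) ->
  \sum_(i < J) omega (cn * (2 ^+ i.+1)^-1) * w i.+2 <= W ->
  (forall m, (0 < m)%N -> (\int[mu]_(z in cube a (2 ^+ m * l)) (`|g z|)%:E <=
    ((2 ^+ m * l) ^+ n.+1 * (w m * B))%:E)%E) ->
  (\int[mu]_(z in S) (`|g z|)%:E <= b%:E)%E ->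
  (\int[mu]_z (majorant c C s a l g J S z)%:E <=
    (c * 8 ^+ n.+1 * W * B + C * (s ^+ n.+1)^-1 * b)%:E)%E.
Proof.
move=> c0 C0 l0 s0 B0 mg mS w_dini gB gS.
have mabs := measurable_absr mg.
have mA (A : set X) : measurable A -> measurable_fun [set: X] (fun z : X => \1_A z * `|g z| : R).
  by move=> ?; apply: measurable_funM; [exact: measurable_indic|exact: mabs].
pose phi i z : R := \1_(cube a (2 ^+ i.+2 * l)) z * `|g z|.
have mphi i : measurable_fun [set: X] (phi i) by apply: mA; exact: measurable_cube.
have v0 i : 0 <= annulus_coef c l i by exact: annulus_coef_ge0.
have phi0 i z : 0 <= phi i z by rewrite mulr_ge0.
have Cs0 : 0 <= C * (s ^+ n.+1)^-1 by rewrite mulr_ge0 ?(ltW C0) // invr_ge0 exprn_ge0 // ltW.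
rewrite /majorant; under eq_integral do rewrite EFinD.
rewrite ge0_integralD; first last.
- apply/measurable_EFinP; apply: measurable_funM; [exact: measurable_cst|exact: mA].
- by move=> z _; rewrite lee_fin; exact: majorant_size_ge0.
- apply/measurable_EFinP; apply: measurable_sum => i.
  by apply: measurable_funM; [exact: measurable_cst|exact: mphi].
- by move=> z _; rewrite lee_fin; exact: majorant_sum_ge0.
- exact: measurableT.
rewrite EFinD; apply: leeD.
  pose bb i := (2 ^+ i.+2 * l) ^+ n.+1 * (w i.+2 * B).
  apply: le_trans (integral_combination_le J v0 phi0 mphi (b := bb) _) _.
    by move=> i; rewrite integral_indicM; exact: gB.
  rewrite lee_fin (eq_bigr _ (fun (i : 'I_J) _ => annulus_coefM c (w i.+2 * B) i l0)).
  under eq_bigr do rewrite !mulrA.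
  rewrite -mulr_suml ler_wpM2r //; under eq_bigr do rewrite -mulrA.
  by rewrite -mulr_sumr ler_wpM2l // mulr_ge0 ?exprn_ge0 // ltW.
under eq_integral do rewrite EFinM.
rewrite ge0_integralZl_EFin; first last.
- exact: Cs0.
- by apply/measurable_EFinP; exact: mA.
- by move=> z _; rewrite lee_fin mulr_ge0.
- exact: measurableT.
by rewrite [X in (_ <= X)%E]EFinM lee_wpmul2l ?lee_fin // integral_indicM.
Qed.

(** Between the radii 2^M d and 3 2^M d there is room for 2^M disjoint shells of
width 2 d, so the lightest one carries at most the fraction 2^-M of the mass. *)
Lemma exists_light_radius a l x g (N0 : R) : 0 < l -> cube a l x ->
  Lebesgue_measurable g -> let d := n.+1%:R * l in
  exists M : nat, forall b,
  (\int[mu]_(z in cube a (2 ^+ (M + (n + 4)) * l)) (`|g z|)%:E <= b%:E)%E ->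
  exists N : R, [/\ N0 < N, 2 ^+ M * d <= N - d, N + d <= 3 * 2 ^+ M * d &
    (\int[mu]_(z in shell x (N - d) (N + d)) (`|g z|)%:E <= (b / 2 ^+ M)%:E)%E].
Proof.
move=> l0 xQ mg d; have d0 : 0 < d by rewrite mulr_gt0 // ltr0n.
pose M := (Num.trunc (`|N0| / d)).+1; exists M => b gb.
have MN : N0 < 2 ^+ M * d.
  apply: le_lt_trans (ler_norm _) _.
  rewrite -ltr_pdivrMr //; apply: lt_trans (truncnS_gt _) _.
  by rewrite -natrX ltr_nat ltn_expl.
have mabs := measurable_absr mg.
have KE : (2 * d) *+ 2 ^ M = 2 * (2 ^+ M * d) by rewrite -mulr_natl natrX; ring.
have p_gt0 : (0 < 2 ^ M)%N by rewrite expn_gt0.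
have d20 : 0 <= 2 * d by rewrite mulr_ge0 // ltW.
have massb : (\int[mu]_(z in shell x (2 ^+ M * d) (2 ^+ M * d + (2 * d) *+ 2 ^ M))
    (`|g z|)%:E <= b%:E)%E.
  apply: le_trans gb; apply: ge0_subset_integral.
  - exact: measurable_shell.
  - exact: measurable_cube.
  - by apply/measurable_EFinP; apply: measurable_funTS.
  - by move=> z _; rewrite lee_fin.
  - move=> z /andP[_ zt]; apply: ball_sub_cube zt _ => //; rewrite KE /d.
    by lra.
have [i iM light] := exists_light_shell d20 p_gt0 mabs (fun=> normr_ge0 _) massb.
have id0 : 0 <= (2 * d) *+ i by rewrite mulrn_wge0.
have iN : (2 * d) *+ i.+1 <= 2 * (2 ^+ M * d).
  by rewrite -KE -[leLHS]mulr_natl -[leRHS]mulr_natl ler_wpM2r // ler_nat.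
have iS : (2 * d) *+ i.+1 = (2 * d) *+ i + 2 * d by rewrite mulrSr.
exists (2 ^+ M * d + (2 * d) *+ i + d).
move: light MN id0 iN iS d0; rewrite natrX; move: (2 ^+ M) => P.
move: ((2 * d) *+ i) ((2 * d) *+ i.+1) => u v light MN u0 vP uv d0.
split; [lra|lra|lra|].
rewrite (_ : P * d + u + d - d = P * d + u); last by ring.
by rewrite (_ : P * d + u + d + d = P * d + v) // uv; ring.
Qed.

Lemma dist_le_of_approx (s1 s2 t1 t2 b e : R) : `|t1 - t2| <= b ->
  `|t1 - s1| < e / 2 -> `|t2 - s2| < e / 2 -> `|s1 - s2| <= b + e.
Proof.
move=> m1 m2 m3; have := ler_distD t1 s1 s2; have := ler_distD t2 t1 s2.
by rewrite (distrC s1 t1); lra.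
Qed.

Context (w : nat -> R) (W : R)
  (w_bound : forall m, 0 <= w m <= 2 ^+ m)
  (w_dini : forall J, \sum_(i < J) omega (cn * (2 ^+ i.+1)^-1) * w i.+2 <= W).

(** Oscillation over Q of T applied to the part of g outside 2 Q. Regularity
yields the Dini sum W. The truncations about x and x' also differ on a shell of
radius N and bounded width, where only the size N^-(n+1) of the kernel is
available; the mean of |g| over the corresponding ball may grow with N, by the
factor w m <= 2^m, and choosing N so that the shell is light compensates for
that growth. *)
Lemma tail_oscillation (C : R) : 0 < C -> exists2 K : R, 0 < K &
  forall a l x x' g (B : R), 0 < l -> 0 <= B -> cube a l x -> cube a l x' ->
    Lebesgue_measurable g ->
    (forall m, (0 < m)%N ->
      (\int[mu]_(z in cube a (2 ^+ m * l)) (`|g z|)%:E <=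
        ((2 ^+ m * l) ^+ n.+1 * (w m * B))%:E)%E) ->
    (\forall z \ae mu, z != x -> `|k x z| <= C * (edist x z ^+ n.+1)^-1) ->
    (\forall z \ae mu, z != x' -> `|k x' z| <= C * (edist x' z ^+ n.+1)^-1) ->
    let h z := \1_(~` cube a (2 * l)) z * g z in
    pv_exists k h x -> pv_exists k h x' ->
    `|singular_integral k h x - singular_integral k h x'| <= K * B.
Proof.
move=> C0; have [c c0 Hc] := kernel_diff_annulus.
have W0 : 0 <= W by have := w_dini 0; rewrite big_ord0.
pose p := (n + 4)%N.
exists (c * 8 ^+ n.+1 * W + C * 2 ^+ (p * n.+1 + p)).
  by rewrite ltr_wpDl ?mulr_gt0 ?exprn_gt0 // !mulr_ge0 ?exprn_ge0 // ltW.
move=> a l x x' g B l0 B0 xQ x'Q mg gB sx sx' h pvx pvx'.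
set K := c * 8 ^+ n.+1 * W + _.
pose d : R := n.+1%:R * l; have d0 : 0 < d by rewrite mulr_gt0 // ltr0n.
have xx' : n.+1%:R * `|x - x'| <= d.
  rewrite ler_wpM2l //; have h1 : `|x - a| <= l / 2 by apply/cubeE => //; exact: ltW.
  have h2 : `|x' - a| <= l / 2 by apply/cubeE => //; exact: ltW.
  by have := ler_distD a x x'; rewrite (distrC a x'); move: h1 h2; lra.
have far (y z : Rn) : cube a l y -> ~ cube a (2 * l) z -> l / 2 < edist y z.
  move=> yQ zQ; apply: lt_le_trans (norm_le_edist _ _).
  have h1 : `|y - a| <= l / 2 by apply/cubeE => //; exact: ltW.
  have h2 : l < `|z - a|.
    rewrite ltNge; apply/negP => zl; apply: zQ; apply/cubeE; move: l0 zl; lra.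
  by have := ler_distD y z a; rewrite (distrC z y); move: h1 h2; lra.
apply/ler_addgt0Pr => eps eps0.
have eps2 : 0 < eps / 2 by rewrite divr_gt0.
have [e1 e10 [N1 apx]] := pv_approx pvx eps2.
have [e2 e20 [N2 apx']] := pv_approx pvx' eps2.
pose e := Num.min (l / 2) (Num.min (e1 / 2) (e2 / 2)).
have e0 : 0 < e by rewrite !lt_min !divr_gt0.
have el : e <= l / 2 by rewrite ge_min lexx.
have ee1 : e < e1 by rewrite !gt_min; apply/or3P; apply: Or32; move: e10; lra.
have ee2 : e < e2 by rewrite !gt_min; apply/or3P; apply: Or33; move: e20; lra.
have [M lightM] := exists_light_radius (Num.max N1 N2) l0 xQ mg.
have [|N [NN ND N3 lightN]] := lightM _ (gB (M + p)%N _); first by rewrite /p !addnS.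
move: NN; rewrite gt_max => /andP[NN1 NN2]; clear lightM.
have h_in z : cube a (2 * l) z -> h z = 0.
  by move=> z2; rewrite /h indicE memNset ?mul0r //; apply.
have h_out z : ~ cube a (2 * l) z -> h z = g z.
  by move=> z2; rewrite /h indicE mem_set ?mul1r.
pose F y z := (fun z => k y z * h z) \_ (annulus y e N) z.
have FE y z : cube a l y -> F y z = if edist y z < N then k y z * h z else 0.
  move=> yQ; rewrite /F patchE; have [z2|z2] := pselect (cube a (2 * l) z).
    by rewrite h_in // mulr0 !if_same.
  have ez : e < edist y z by apply: le_lt_trans (far y z yQ z2).
  congr (if _ then _ else _); apply/idP/idP.
    by rewrite inE => /andP[].
  by move=> yN; rewrite inE; apply/andP.
have iF y : pv_exists k h y -> mu.-integrable setT (EFin \o F y).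
  move=> pvy; have := pvy.1 e N e0.
  by move/(integrable_mkcond _ (measurable_annulus y e N)); rewrite restrict_EFin.
have tE y : truncated k h y (e, N) = (\int[mu]_z F y z)%R.
  by rewrite /truncated Rintegral_mkcond.
have Md0 : 0 < 2 ^+ M * d by rewrite mulr_gt0 ?exprn_gt0.
pose Psi := majorant c C (2 ^+ M * d) a l g (M + p) (shell x (N - d) (N + d)).
have bound : \forall z \ae mu, `|F x z - F x' z| <= Psi z.
  apply: ae_imp (ae_and sx sx') => z [kx kx'].
  rewrite !FE //; have [z2|z2] := pselect (cube a (2 * l) z).
    rewrite h_in // !mulr0 !if_same subrr normr0.
    by apply: addr_ge0; [exact: majorant_sum_ge0|exact: majorant_size_ge0].
  have ne y : cube a l y -> z != y.
    move=> yQ; apply/eqP => zy; have := far y z yQ z2; rewrite zy edistxx.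
    by apply/negP; rewrite -leNgt divr_ge0 // ltW.
  rewrite h_out //; apply: truncation_diff_le => //.
  - by move=> j j0 zj; exact: Hc xQ x'Q j0 zj.
  - by apply: le_trans xx'; exact: edist_lipschitz.
  - move=> zN; apply: (@cube_scale_sub a l (M + p)) => //.
    apply: ball_sub_cube zN _ => //; move: N3 d0; rewrite /d; lra.
  - by apply: kx; exact: ne.
  - by apply: kx'; exact: ne.
have intPsi : (\int[mu]_z (Psi z)%:E <= (K * B)%:E)%E.
  apply: le_trans (integral_majorant_le c0 C0 l0 Md0 B0 mg _ (w_dini _) gB lightN) _.
    exact: measurable_shell.
  rewrite lee_fin /K mulrDl lerD2l.
  have ld : l <= d by rewrite ler_peMl ?(ltW l0) // ler1n.
  have b1 : (2 ^+ (M + p) * l) ^+ n.+1 * (w (M + p) * B) <=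
      (2 ^+ p * (2 ^+ M * d)) ^+ n.+1 * (2 ^+ (M + p) * B).
    have /andP[w0 w1] := w_bound (M + p).
    apply: ler_pM; first by rewrite exprn_ge0 // mulr_ge0 ?exprn_ge0 // ltW.
    - by rewrite mulr_ge0.
    - rewrite lerXn2r ?nnegrE ?mulr_ge0 ?exprn_ge0 ?(ltW l0) ?(ltW d0) //.
      rewrite exprD [leLHS](_ : _ = 2 ^+ p * (2 ^+ M * l)); last by ring.
      by rewrite ler_wpM2l ?exprn_ge0 // ler_wpM2l ?exprn_ge0.
    - by rewrite ler_wpM2r.
  apply: (@le_trans _ _ (C * ((2 ^+ M * d) ^+ n.+1)^-1 *
      ((2 ^+ p * (2 ^+ M * d)) ^+ n.+1 * (2 ^+ (M + p) * B) / 2 ^+ M))).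
    rewrite ler_wpM2l ?mulr_ge0 ?invr_ge0 ?exprn_ge0 ?(ltW C0) ?(ltW Md0) //.
    by rewrite ler_wpM2r // invr_ge0 exprn_ge0.
  rewrite le_eqVlt; apply/orP; left; apply/eqP.
  rewrite [(2 ^+ p * _) ^+ _]exprMn (exprD _ M) (exprD _ (p * n.+1)) exprM.
  have := expf_neq0 n.+1 (lt0r_neq0 Md0).
  have : 2 ^+ M != 0 :> R by rewrite expf_neq0.
  move: (2 ^+ M) (2 ^+ p) => P1 P3.
  by move: (P3 ^+ n.+1) ((P1 * d) ^+ n.+1) => P2 Q P10 Q0; field; rewrite P10 Q0.
have main : `|truncated k h x (e, N) - truncated k h x' (e, N)| <= K * B.
  rewrite !tE; apply: (Rintegral_dist_le (Psi := Psi)).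
  - exact: iF.
  - exact: iF.
  - by apply: measurable_majorant => //; exact: measurable_shell.
  - by move=> z; apply: addr_ge0; [exact: majorant_sum_ge0|exact: majorant_size_ge0].
  - exact: bound.
  - exact: intPsi.
apply: dist_le_of_approx main (apx e N _ NN1) (apx' e N _ NN2).
  by rewrite e0 ee1.
by rewrite e0 ee2.
Qed.

End tail.

(** * Means of order r *)

Section means.
Context {R : realType} {n : nat}.
Local Notation Rn := 'rV[R]_n.+1.
Local Notation X := (caratheodory_type (@leb_outer R n)).
Local Notation mu := (@leb R n).
Implicit Types (x y z a : Rn) (f g : Rn -> R).

Lemma measurable_absr_powR g (r : R) : Lebesgue_measurable g ->
  measurable_fun [set: X] (fun z : X => `|g z| `^ r).
Proof.
move=> mg; apply: (@measurableT_comp _ _ _ _ _ _ (fun u : R => u `^ r)).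
  exact: measurable_powR.
exact: measurable_absr.
Qed.

Lemma avg_ge0 a (l : R) (phi : Rn -> R) : 0 < l -> (forall z, 0 <= phi z) ->
  (0 <= avg (cube a l) phi)%E.
Proof.
move=> l0 phi0; apply: mule_ge0; first by rewrite inve_ge0.
by apply: integral_ge0 => z _; rewrite lee_fin.
Qed.

Lemma integral_le_avg a (l b : R) (phi : Rn -> R) : 0 < l -> 0 <= b ->
  (avg (cube a l) phi <= b%:E)%E ->
  (\int[mu]_(z in cube a l) (phi z)%:E <= ((2 * l) ^+ n.+1 * b)%:E)%E.
Proof.
move=> l0 b0; rewrite /avg.
have mfin := leb_cube_fin a l0; have m0 := leb_cube_gt0 a l0.
have le2 := leb_cube_le a l0.
move: mfin m0 le2; case: (leb n (cube a l)) => // m _ m0 le2.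
rewrite inver gt_eqF; last by rewrite -lte_fin.
rewrite lee_pdivrMl; last by rewrite -lte_fin.
move=> /le_trans; apply; by rewrite -EFinM lee_fin ler_wpM2r.
Qed.

(** For t > B this is u <= u^r with u = t / B. *)
Lemma le_powR_self (B t r : R) : 0 < B -> 0 <= t -> 1 <= r ->
  t <= B + B / B `^ r * t `^ r.
Proof.
move=> B0 t0 r1; have BP : 0 < B `^ r by exact: powR_gt0.
have [tB|Bt] := leP t B.
  by apply: le_trans tB _; rewrite lerDl mulr_ge0 ?powR_ge0 // divr_ge0 // ltW.
have u1 : 1 <= t / B by rewrite ler_pdivlMr // mul1r ltW.
have := le1r_powR u1 r1.
have tBr : (t / B) `^ r = t `^ r / B `^ r.
  rewrite powRM ?invr_ge0 ?(ltW B0) //; congr (_ * _).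
  by rewrite -[B^-1]powR_inv1 ?(ltW B0) // powRAC powR_inv1 // ltW.
rewrite tBr ler_pdivrMr // => h.
apply: (@le_trans _ _ (t `^ r / B `^ r * B)) => //.
by rewrite [leRHS](_ : _ = B + t `^ r / B `^ r * B) ?lerDr ?(ltW B0) //; ring.
Qed.

(** Integrating [le_powR_self] replaces Hoelder's inequality, at the price of a
factor 2. *)
Lemma Lr_mean_mass a (l B r : R) g : 0 < l -> 0 < B -> 1 <= r ->
  Lebesgue_measurable g ->
  (avg (cube a l) (fun z => `|g z| `^ r)%R `^ r^-1 <= B%:E)%E ->
  (\int[mu]_(z in cube a l) (`|g z| `^ r)%:E <= ((2 * l) ^+ n.+1 * B `^ r)%:E)%E /\
  (\int[mu]_(z in cube a l) (`|g z|)%:E <= ((2 * l) ^+ n.+1 * (2 * B))%:E)%E.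
Proof.
move=> l0 B0 r1 mg gB.
have r0 : 0 < r by apply: lt_le_trans r1.
have BP : 0 < B `^ r by exact: powR_gt0.
have I1 : (\int[mu]_(z in cube a l) (`|g z| `^ r)%:E <=
    ((2 * l) ^+ n.+1 * B `^ r)%:E)%E.
  apply: integral_le_avg => //; first exact: powR_ge0.
  have A0 : (0 <= avg (cube a l) (fun z => `|g z| `^ r)%R)%E.
    by apply: avg_ge0 => // z; exact: powR_ge0.
  rewrite -[leLHS]poweRe1 // -(mulVf (lt0r_neq0 r0)) poweRrM -poweR_EFin.
  apply: gt0_ler_poweR => //; first exact: ltW.
    by rewrite in_itv /= poweR_ge0 leey.
  by rewrite in_itv /= leey andbT lee_fin ltW.
split => //.
have mQ := measurable_cube a l.
have mabs : measurable_fun (cube a l : set X) (fun z : X => (`|g z|)%:E).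
  by apply/measurable_EFinP/measurable_funTS; exact: measurable_absr.
have mpow : measurable_fun (cube a l : set X) (fun z : X => `|g z| `^ r).
  by apply/measurable_funTS; exact: measurable_absr_powR.
have BB : 0 <= B / B `^ r by rewrite divr_ge0 // ltW.
apply: (@le_trans _ _ (\int[mu]_(z in cube a l)
    (B%:E + (B / B `^ r)%:E * (`|g z| `^ r)%:E))%E).
  apply: ge0_le_integral.
  - exact: mQ.
  - by move=> z _; rewrite lee_fin.
  - exact: mabs.
  - apply: emeasurable_funD; first exact: measurable_cst.
    apply/measurable_EFinP; apply: measurable_funM; [exact: measurable_cst|exact: mpow].
  - by move=> z _; rewrite -EFinM -EFinD lee_fin; exact: le_powR_self.
rewrite ge0_integralD; first last.
- apply/measurable_EFinP; apply: measurable_funM; [exact: measurable_cst|exact: mpow].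
- by move=> z _; rewrite -EFinM lee_fin mulr_ge0 // powR_ge0.
- exact: measurable_cst.
- by move=> z _; rewrite lee_fin ltW.
- exact: mQ.
rewrite ge0_integralZl_EFin; first last.
- exact: BB.
- exact/measurable_EFinP.
- by move=> z _; rewrite lee_fin powR_ge0.
- exact: mQ.
rewrite integral_cst // [X in (_ <= X)%E](_ : _ = B%:E * ((2 * l) ^+ n.+1)%:E +
  (B / B `^ r)%:E * ((2 * l) ^+ n.+1 * B `^ r)%:E)%E; last first.
  by rewrite -!EFinM -EFinD; congr EFin; field; rewrite gt_eqF.
apply: leeD; apply: lee_wpmul2l; rewrite ?lee_fin ?(ltW B0) //.
exact: leb_cube_le.
Qed.

(** When A is an infimum, each B > A exceeds some value, whereas A need not be
attained; B is positive, so that division by B is possible. *)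
Lemma lee_mul_of_lt (L A : \bar R) (K : R) : 0 < K -> (0 <= A)%E ->
  (forall B : R, 0 < B -> (A < B%:E)%E -> (L <= (K * B)%:E)%E) -> (L <= K%:E * A)%E.
Proof.
move=> K0; case: A => [A| |//] A0 H; last by rewrite gt0_muley ?lte_fin // leey.
rewrite -EFinM; apply/lee_addgt0Pr => eps eps0; rewrite -EFinD.
have e0 : 0 < eps / K by rewrite divr_gt0.
rewrite lee_fin in A0.
have := H (A + eps / K); rewrite ltr_wpDl // lte_fin ltrDl e0 => /(_ isT isT).
by rewrite mulrDr [K * (eps / K)]mulrC divfK // gt_eqF.
Qed.

End means.

(** * Local oscillation of singular integrals *)

Section local_oscillation.
Context {R : realType} {n : nat}.
Local Notation Rn := 'rV[R]_n.+1.
Local Notation X := (caratheodory_type (@leb_outer R n)).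
Local Notation mu := (@leb R n).
Implicit Types (x y z a : Rn) (f g F : Rn -> R).
Context (k : Rn -> Rn -> R) (omega : R -> R) (cn r s : R)
  (hcn : dim_const n cn)
  (omega_nd : forall t u : R, 0 < t -> t <= u -> omega t <= omega u)
  (hk : kernel_regularity k omega) (hr : 1 <= r)
  (T_on_Lr : forall f : Rn -> R, in_Lr r f -> singular_integral_domain k f)
  (T_weak : weak_type r (singular_integral k)) (s0 : 0 < s).

Lemma local_osc_le (alpha c : R) F (Q : set Rn) : 0 <= alpha ->
  (mu [set y | Q y /\ (alpha < `|F y - c|)%R] < s%:E * mu Q)%E ->
  (local_osc s F Q <= alpha%:E)%E.
Proof.
move=> a0 H; apply: le_trans (ereal_inf_lbound _) _.
  by exists c.
by apply: ereal_inf_lbound; exists alpha.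
Qed.

Lemma measurable_indicM (A : set Rn) g : measurable (A : set X) ->
  Lebesgue_measurable g -> Lebesgue_measurable (fun z => \1_A z * g z).
Proof.
move=> mA mg; apply: measurable_funM; [exact: measurable_indic|exact: mg].
Qed.

Lemma in_Lr_restrict (A : set Rn) g (b : R) : measurable (A : set X) ->
  Lebesgue_measurable g -> (\int[mu]_(z in A) (`|g z| `^ r)%:E <= b%:E)%E ->
  in_Lr r (fun z => \1_A z * g z) /\
  (\int[mu]_z (`|\1_A z * g z| `^ r)%:E <= b%:E)%E.
Proof.
move=> mA mg gb.
have E : (\int[mu]_z (`|\1_A z * g z| `^ r)%:E = \int[mu]_(z in A) (`|g z| `^ r)%:E)%E.
  rewrite -[RHS]integral_indicM; apply: eq_integral => z _; congr EFin.
  rewrite indicE; case: (_ \in _); rewrite ?mul1r // !mul0r normr0 powR0 //.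
  by rewrite gt_eqF // (lt_le_trans ltr01).
rewrite E; split; last exact: gb.
apply: in_LrP; [exact: hr|exact: measurable_indicM|].
by rewrite E; apply: le_lt_trans gb _; rewrite ltry.
Qed.

Lemma ler_dist_split (u v t : R) : `|u - t| <= `|u - v - t| + `|v|.
Proof. by have := ler_normD (u - v - t) v; rewrite addrAC subrK. Qed.

Lemma indicC_sub (A : set Rn) g : (fun z => \1_(~` A) z * g z) = g \- (fun z => \1_A z * g z).
Proof.
apply/funext => z /=; rewrite !indicE in_setC; case: (_ \in _) => /=.
  by rewrite mul0r mul1r subrr.
by rewrite mul0r mul1r subr0.
Qed.

Section weights.
Context (w : nat -> R) (W : R)
  (w_bound : forall m, 0 <= w m <= 2 ^+ m)
  (w_dini : forall J, \sum_(i < J) omega (cn * (2 ^+ i.+1)^-1) * w i.+2 <= W).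

(** The part of g in 2 Q is handled by the weak-type inequality; T applied to the
rest is nearly constant on Q by [tail_oscillation], and its value at one good
point x0 of Q serves as the constant c of the local oscillation. The hypotheses
on g are means over the dilates of Q: w m B bounds, up to a dimensional factor,
the mean of |g| over 2^m Q. *)
Lemma local_osc_singular_integral_le : exists2 K : R, 0 < K &
  forall a (l : R) g F (B : R), 0 < l -> 0 < B -> singular_integral_domain k g ->
    (\forall y \ae mu, F y = singular_integral k g y) ->
    (\int[mu]_(z in cube a (2 * l)) (`|g z| `^ r)%:E <= ((4 * l) ^+ n.+1 * B `^ r)%:E)%E ->
    (forall m, (0 < m)%N -> (\int[mu]_(z in cube a (2 ^+ m * l)) (`|g z|)%:E <=
        ((2 ^+ m * l) ^+ n.+1 * (w m * B))%:E)%E) ->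
    (local_osc s F (cube a l) <= (K * B)%:E)%E.
Proof.
have [C C0 size] := ae_kernel_size omega_nd hk hr T_on_Lr T_weak.
have [K0 K00 tail] := tail_oscillation omega_nd hk hcn w_bound w_dini C0.
have [c0 weak] := T_weak.
pose c := Num.max c0 0; have c_ge0 : 0 <= c by rewrite le_max lexx orbT.
(* As C2 <= C2^r, the weak-type bound at the level C2 B is less than s |Q|. *)
pose C2 := c * 4 ^+ n.+1 / s + 1.
have C21 : 1 <= C2 by rewrite lerDr !mulr_ge0 ?exprn_ge0 ?invr_ge0 // ltW.
have C20 : 0 < C2 by apply: lt_le_trans C21.
exists (K0 + C2); first by rewrite addr_gt0.
move=> a l g F B l0 B0 [mg pvg] FE gr gB.
have mQ2 : measurable (cube a (2 * l) : set X) by exact: measurable_cube.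
pose g1 z := \1_(cube a (2 * l)) z * g z.
pose h z := \1_(~` cube a (2 * l)) z * g z.
have [g1r g1I] := in_Lr_restrict mQ2 mg gr.
have [_ pvg1] := T_on_Lr g1r.
have good := ae_and (ae_and pvg pvg1) (ae_and size FE).
have hE : h = g \- g1 by exact: indicC_sub.
have [x0 x0Q [[pg0 pg10] [[_ size0] _]]] := ae_cube_ex a l0 good.
have pv_h y : pv_exists k g y -> pv_exists k g1 y -> pv_exists k h y /\
    singular_integral k h y = singular_integral k g y - singular_integral k g1 y.
  by move=> p1 p2; rewrite hE; exact: pv_existsB.
have [ph0 _] := pv_h _ pg0 pg10.
apply: (@local_osc_le _ (singular_integral k h x0)).
  by rewrite mulr_ge0 ?(ltW B0) // addr_ge0 // ltW.
have BC0 : 0 < C2 * B by rewrite mulr_gt0.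
have sub : (leb n [set y | cube a l y /\
      ((K0 + C2) * B < `|F y - singular_integral k h x0|)%R] <=
    leb n [set y | (C2 * B < `|singular_integral k g1 y|)%R])%E.
  apply: measure_ae_le good _ => y [[pg pg1] [[_ sizey] Fy]] [yQ /= yB].
  have [ph hy] := pv_h _ pg pg1.
  have := tail a l y x0 g B l0 (ltW B0) yQ x0Q mg gB sizey size0 ph ph0.
  rewrite -/h hy => tl.
  rewrite ltNge; apply/negP => small; move: yB; apply/negP; rewrite -leNgt Fy mulrDl.
  by apply: le_trans (ler_dist_split _ (singular_integral k g1 y) _) _; exact: lerD.
apply: le_lt_trans sub _.
have := weak g1 g1r (C2 * B) BC0; rewrite LnormX // => wk.
have r0 : 0 < r by apply: lt_le_trans hr.
have P0 : 0 < (C2 * B) `^ r by exact: powR_gt0.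
have wk2 : (((C2 * B) `^ r)%:E *
    leb n [set y | (C2 * B < `|singular_integral k g1 y|)%R] <=
    (c * ((4 * l) ^+ n.+1 * B `^ r))%:E)%E.
  apply: le_trans wk _; rewrite EFinM.
  apply: (@le_trans _ _ (c%:E * \int[mu]_z (`|g1 z| `^ r)%:E)%E).
    apply: lee_wpmul2r; last by rewrite lee_fin le_max lexx.
    by apply: integral_ge0 => z _; rewrite lee_fin powR_ge0.
  by apply: lee_wpmul2l => //; rewrite lee_fin.
rewrite ltNge; apply/negP => ge.
have sl : ((s * l ^+ n.+1)%:E <= s%:E * leb n (cube a l))%E.
  by rewrite EFinM lee_wpmul2l ?lee_fin ?(ltW s0) //; exact: leb_cube_ge.
have := le_trans (lee_wpmul2l (ltW P0 : (0 <= _%:E)%E) (le_trans sl ge)) wk2.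
rewrite -EFinM lee_fin; apply/negP; rewrite -ltNge.
rewrite powRM ?(ltW C20) ?(ltW B0) // exprMn.
have Br0 : 0 < B `^ r by exact: powR_gt0.
have l0' : 0 < l ^+ n.+1 by exact: exprn_gt0.
rewrite [ltLHS](_ : _ = c * 4 ^+ n.+1 * (B `^ r * l ^+ n.+1)); last by ring.
rewrite [ltRHS](_ : _ = C2 `^ r * s * (B `^ r * l ^+ n.+1)); last by ring.
rewrite ltr_pM2r ?mulr_gt0 //; apply: (@lt_le_trans _ _ (C2 * s)).
  by rewrite /C2 mulrDl mul1r divfK ?gt_eqF // ltrDl.
by rewrite ler_wpM2r ?(ltW s0) //; exact: le1r_powR.
Qed.

End weights.

Lemma cube_mean_of_Mr a (l B : R) f y (m : nat) : 0 < l -> 0 < B ->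
  Lebesgue_measurable f -> cube a l y -> (Mr r f y < B%:E)%E ->
  (avg (cube a (2 ^+ m * l)) (fun z => `|f z| `^ r)%R `^ r^-1 <= B%:E)%E.
Proof.
move=> l0 B0 mf yQ yB; apply: le_trans (ltW yB).
have ml0 : 0 < 2 ^+ m * l by rewrite mulr_gt0 // exprn_gt0.
have r0 : 0 <= r^-1 by rewrite invr_ge0 (le_trans ler01).
have avg0 : (0 <= avg (cube a (2 ^+ m * l)) (fun z => `|f z| `^ r)%R)%E.
  by apply: avg_ge0 => // z; exact: powR_ge0.
have avgM : (avg (cube a (2 ^+ m * l)) (fun z => `|f z| `^ r)%R <=
    HLmax (fun z => `|f z| `^ r)%R y)%E.
  apply: ereal_sup_ubound; exists (cube a (2 ^+ m * l)).
    split; first by exists a, (2 ^+ m * l).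
    by apply: (@cube_scale_sub _ _ a l 0 m) => //; rewrite mul1r.
  congr (avg _ _); apply/funext => z; apply: ger0_norm; exact: powR_ge0.
apply: gt0_ler_poweR => //.
  by rewrite in_itv /= avg0 leey.
by rewrite in_itv /= leey andbT (le_trans avg0).
Qed.

Lemma cube_mean_of_Msharp a (l B : R) f y (m : nat) : 0 < l ->
  cube a l y -> (Msharp r f y < B%:E)%E ->
  exists c : R,
  (avg (cube a (2 ^+ m * l)) (fun z => `|f z - c| `^ r)%R `^ r^-1 <= B%:E)%E.
Proof.
move=> l0 yQ yB.
have ml0 : 0 < 2 ^+ m * l by rewrite mulr_gt0 // exprn_gt0.
set Q' := cube a (2 ^+ m * l).
have : (ereal_inf [set avg Q' (fun z => `|f z - c| `^ r)%R `^ r^-1 | c in [set: R]] < B%:E)%E.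
  apply: le_lt_trans yB; apply: ereal_sup_ubound; exists Q' => //.
  split; first by exists a, (2 ^+ m * l).
  by apply: (@cube_scale_sub _ _ a l 0 m) => //; rewrite mul1r.
by move=> /ereal_inf_lt [_ [c _ <-] cB]; exists c; exact: ltW.
Qed.

Lemma dim_factor_ge1 : 1 <= 2 * 2 ^+ n.+1 :> R.
Proof. by rewrite -exprS exprn_ege1 // ler1n. Qed.

Lemma Mr_ge0 f y : (0 <= Mr r f y)%E. Proof. exact: poweR_ge0. Qed.

Lemma Msharp_ge0 f y : (0 <= Msharp r f y)%E.
Proof.
have yQ : cube y 1 y by move=> i; rewrite subrr normr0.
apply: (@le_trans _ _ (ereal_inf [set avg (cube y 1) (fun z => `|f z - c| `^ r)%R `^ r^-1
  | c in [set: R]])%E).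
  by apply: le_ereal_inf_tmp => _ [c _ <-]; exact: poweR_ge0.
by apply: ereal_sup_ubound; exists (cube y 1) => //; split => //; exists y, 1.
Qed.

Lemma local_osc_le_Mr :
  (\int[@lebesgue_measure R]_(t in `]0%R, 1%R[) (omega (cn * t) / t)%:E < +oo)%E ->
  exists2 K : R, 0 < K & forall a (l : R) f, 0 < l -> singular_integral_domain k f ->
    (local_osc s (singular_integral k f) (cube a l) <=
      K%:E * ereal_inf [set Mr r f y | y in cube a l])%E.
Proof.
move=> Dini.
have [W HW] := dini_sum_bounded hcn omega_nd (omega_ge0 omega_nd hk) Dini.
have w1 m : 0 <= (1 : R) <= 2 ^+ m by rewrite ler01 exprn_ege1 // ler1n.
have wW J : \sum_(i < J) omega (cn * (2 ^+ i.+1)^-1) * 1 <= W.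
  by under eq_bigr do rewrite mulr1.
have [K K0 core] := local_osc_singular_integral_le w1 wW.
pose D : R := 2 * 2 ^+ n.+1; have D1 : 1 <= D by exact: dim_factor_ge1.
have D0 : 0 < D by apply: lt_le_trans D1.
exists (K * D); first by rewrite mulr_gt0.
move=> a l f l0 fdom; have [mf _] := fdom.
apply: lee_mul_of_lt; first by rewrite mulr_gt0.
  by apply: le_ereal_inf_tmp => _ [y _ <-]; exact: Mr_ge0.
move=> B B0 /ereal_inf_lt [_ [y yQ <-] yB].
have ml0 m : 0 < 2 ^+ m * l by rewrite mulr_gt0 // exprn_gt0.
have mass m := Lr_mean_mass (ml0 m) B0 hr mf (cube_mean_of_Mr m l0 B0 mf yQ yB).
rewrite -mulrA; apply: (core a l f _ (D * B) l0 _ fdom).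
- by rewrite mulr_gt0.
- exact: aeW.
- have := (mass 1%N).1; rewrite expr1 => /le_trans; apply.
  rewrite lee_fin mulrA -natrM; apply: ler_wpM2l; first by rewrite exprn_ge0 // mulr_ge0 // ltW.
  apply: ge0_ler_powR; rewrite ?nnegrE ?mulr_ge0 ?(ltW B0) ?(ltW D0) ?(le_trans ler01 hr) //.
  by rewrite ler_peMl // ltW.
- move=> m _; apply: le_trans (mass m).2 _; rewrite lee_fin exprMn /D.
  by rewrite le_eqVlt; apply/orP; left; apply/eqP; ring.
Qed.

(** The constants that nearly realize the infimum for two consecutive dilates of
Q differ by at most a multiple of B, since the smaller dilate has a comparable
measure. Summing over the scales, the mean of |f - c| over 2^m Q, with the
constant c of 2 Q, grows at most linearly in m. *)
Lemma mass_about_constant : exists2 D : R, 1 <= D & forall a (l : R) f y (B : R),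
  0 < l -> 0 < B -> Lebesgue_measurable f -> cube a l y ->
  (Msharp r f y < B%:E)%E -> exists c : R,
  (\int[mu]_(z in cube a (2 * l)) (`|f z - c| `^ r)%:E <= ((4 * l) ^+ n.+1 * B `^ r)%:E)%E /\
  forall m, (0 < m)%N -> (\int[mu]_(z in cube a (2 ^+ m * l)) (`|f z - c|)%:E <=
    ((2 ^+ m * l) ^+ n.+1 * (m%:R * (D * B)))%:E)%E.
Proof.
pose E : R := 2 ^+ n.+1; have E1 : 1 <= E by rewrite exprn_ege1 // ler1n.
pose D2 : R := 2 * E * (1 + E).
have D2E : 2 * E <= D2 by rewrite ler_peMr ?mulr_ge0 //; lra.
have D20 : 0 <= D2 by apply: le_trans D2E; rewrite mulr_ge0 //; lra.
exists (E * D2).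
  by rewrite mulr_ege1 // (le_trans _ D2E) //; lra.
move=> a l f y B l0 B0 mf yQ yB.
have ml0 m : 0 < 2 ^+ m * l by rewrite mulr_gt0 // exprn_gt0.
have mfc c : Lebesgue_measurable (fun z => f z - c).
  by apply: measurable_funB; [exact: mf|exact: measurable_cst].
have [c Hc] := choice (fun m => cube_mean_of_Msharp m l0 yQ yB).
have mass m := Lr_mean_mass (ml0 m) B0 hr (mfc _) (Hc m).
have massE m : (\int[mu]_(z in cube a (2 ^+ m * l)) (`|f z - c m|)%:E <=
    ((2 ^+ m * l) ^+ n.+1 * (2 * E * B))%:E)%E.
  apply: le_trans (mass m).2 _; rewrite lee_fin exprMn -/E.
  by rewrite le_eqVlt; apply/orP; left; apply/eqP; ring.
have mQ m : measurable (cube a (2 ^+ m * l) : set X) by exact: measurable_cube.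
have mabs c' (A : set X) : measurable_fun A (fun z : X => (`|f z - c'|)%:E).
  by apply/measurable_EFinP/measurable_funTS; exact: measurable_absr.
have change c1 c2 m : (\int[mu]_(z in cube a (2 ^+ m * l)) (`|f z - c1|)%:E <=
    \int[mu]_(z in cube a (2 ^+ m * l)) (`|f z - c2|)%:E +
    (`|c2 - c1|)%:E * leb n (cube a (2 ^+ m * l)))%E.
  rewrite -integral_cst; last exact: mQ.
  rewrite -ge0_integralD; first last.
  - exact: measurable_cst.
  - by move=> z _; rewrite lee_fin.
  - exact: mabs.
  - by move=> z _; rewrite lee_fin.
  - exact: mQ.
  apply: ge0_le_integral.
  - exact: mQ.
  - by move=> z _; rewrite lee_fin.
  - exact: mabs.
  - by apply: emeasurable_funD; [exact: mabs|exact: measurable_cst].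
  - by move=> z _; rewrite -EFinD lee_fin; exact: ler_distD.
have step m : `|c m.+1 - c m| <= D2 * B.
  have P0 : 0 < (2 ^+ m * l) ^+ n.+1 by exact: exprn_gt0.
  have SE : (2 ^+ m.+1 * l) ^+ n.+1 = E * (2 ^+ m * l) ^+ n.+1.
    by rewrite -exprMn mulrA -exprS.
  have sum2 : (\int[mu]_(z in cube a (2 ^+ m * l)) (`|f z - c m|)%:E +
      \int[mu]_(z in cube a (2 ^+ m * l)) (`|f z - c m.+1|)%:E <=
      ((2 ^+ m * l) ^+ n.+1 * (D2 * B))%:E)%E.
    rewrite (_ : _ * (D2 * B) = (2 ^+ m * l) ^+ n.+1 * (2 * E * B) +
      (2 ^+ m.+1 * l) ^+ n.+1 * (2 * E * B)); last by rewrite SE /D2; ring.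
    rewrite EFinD; apply: leeD; first exact: massE.
    apply: le_trans (massE m.+1); apply: ge0_subset_integral.
    - exact: mQ.
    - exact: mQ.
    - exact: mabs.
    - by move=> z _; rewrite lee_fin.
    - exact: cube_scale_sub.
  rewrite -(ler_pM2l P0) -lee_fin; apply: le_trans sum2.
  apply: (@le_trans _ _ ((`|c m.+1 - c m|)%:E * leb n (cube a (2 ^+ m * l)))%E).
    by rewrite mulrC EFinM; apply: lee_wpmul2l; [rewrite lee_fin|exact: leb_cube_ge].
  rewrite -integral_cst; last exact: mQ.
  rewrite -ge0_integralD; first last.
  - exact: mabs.
  - by move=> z _; rewrite lee_fin.
  - exact: mabs.
  - by move=> z _; rewrite lee_fin.
  - exact: mQ.
  apply: ge0_le_integral.
  - exact: mQ.
  - by move=> z _; rewrite lee_fin.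
  - exact: measurable_cst.
  - by apply: emeasurable_funD; exact: mabs.
  - move=> z _; rewrite -EFinD lee_fin [leRHS]addrC (distrC (f z) (c m.+1)).
    exact: ler_distD.
have drift m : `|c 1%N - c m.+1| <= m%:R * (D2 * B).
  elim: m => [|m IH]; first by rewrite subrr normr0 mul0r.
  apply: le_trans (ler_distD (c m.+1) _ _) _; rewrite -[m.+1%:R]natr1 mulrDl mul1r.
  by apply: lerD => //; rewrite distrC; exact: step.
exists (c 1%N); split.
  by have := (mass 1%N).1; rewrite expr1 mulrA -natrM.
case=> // m _; apply: le_trans (change (c 1%N) (c m.+1) _) _.
have P0 : 0 <= (2 ^+ m.+1 * l) ^+ n.+1 by rewrite exprn_ge0 // ltW.
apply: (@le_trans _ _ (((2 ^+ m.+1 * l) ^+ n.+1 * (2 * E * B))%:E +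
    (m%:R * (D2 * B) * (E * (2 ^+ m.+1 * l) ^+ n.+1))%:E)%E).
  apply: leeD; first exact: massE.
  rewrite [X in (_ <= X)%E]EFinM; apply: lee_pmul => //; first by rewrite lee_fin distrC; exact: drift.
  by rewrite -exprMn; exact: leb_cube_le.
rewrite -EFinD lee_fin [X in _ + X](_ : _ =
  (2 ^+ m.+1 * l) ^+ n.+1 * (m%:R * (E * D2 * B))); last by ring.
rewrite -mulrDr ler_wpM2l // -[m.+1%:R]natr1 [leRHS]mulrDl mul1r [leRHS]addrC lerD2r.
rewrite ler_wpM2r ?(ltW B0) //; apply: le_trans D2E _.
exact: ler_peMl.
Qed.

(** As T annihilates constants, f may be replaced by f - c, where c is the constant
of [mass_about_constant]; the linear growth of the means is paid for by the
logarithm in the second Dini condition. *)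
Lemma local_osc_le_Msharp :
  (\int[@lebesgue_measure R]_(t in `]0%R, 1%R[) (omega (cn * t) / t)%:E < +oo)%E ->
  annihilates_constants k ->
  (\int[@lebesgue_measure R]_(t in `]0%R, 1%R[)
      (omega (cn * t) * ln t^-1 / t)%:E < +oo)%E ->
  exists2 K : R, 0 < K & forall a (l : R) f, 0 < l -> singular_integral_domain k f ->
    (local_osc s (singular_integral k f) (cube a l) <=
      K%:E * ereal_inf [set Msharp r f y | y in cube a l])%E.
Proof.
move=> Dini T1 Dinilog.
have o0 := omega_ge0 omega_nd hk.
have [W1 HW1] := dini_sum_bounded hcn omega_nd o0 Dini.
have [W2 HW2] := dini_log_sum_bounded hcn omega_nd o0 Dinilog.
have wm m : 0 <= (m%:R : R) <= 2 ^+ m by rewrite ler0n -natrX ler_nat ltnW // ltn_expl.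
have wW J : \sum_(i < J) omega (cn * (2 ^+ i.+1)^-1) * i.+2%:R <= W2 + 2 * W1.
  apply: le_trans (lerD (HW2 J) (ler_wpM2l (ler0n _ 2) (HW1 J))).
  rewrite mulr_sumr -big_split /=; apply: ler_sum => i _.
  rewrite (_ : i.+2%:R = i%:R + 2 :> R); last by rewrite -[RHS]natrD addn2.
  by rewrite mulrDr lerD2l mulrC.
have [K K0 core] := local_osc_singular_integral_le wm wW.
have [D D1 mass] := mass_about_constant.
have D0 : 0 < D by apply: lt_le_trans D1.
exists (K * D); first by rewrite mulr_gt0.
move=> a l f l0 [mf pvf].
apply: lee_mul_of_lt; first by rewrite mulr_gt0.
  by apply: le_ereal_inf_tmp => _ [y _ <-]; exact: Msharp_ge0.
move=> B B0 /ereal_inf_lt [_ [y yQ <-] yB].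
have [c [m1 m2]] := mass a l f y B l0 B0 mf yQ yB.
have [[_ pvc] c0] := T1 c.
have pvfc : \forall x \ae mu, pv_exists k (f \- cst c) x /\
    singular_integral k f x = singular_integral k (f \- cst c) x.
  apply: ae_imp (ae_and (ae_and pvf pvc) c0) => x [[pf pc] E0].
  have [h1 h2] := pv_existsB pf pc; split => //.
  by rewrite h2 E0 subr0.
rewrite -mulrA; apply: (core a l (f \- cst c) _ (D * B) l0).
- by rewrite mulr_gt0.
- split; first by apply: measurable_funB; [exact: mf|exact: measurable_cst].
  by apply: ae_imp pvfc => x [].
- by apply: ae_imp pvfc => x [].
- apply: le_trans m1 _; rewrite lee_fin ler_wpM2l ?exprn_ge0 ?mulr_ge0 ?(ltW l0) //.
  apply: ge0_ler_powR; rewrite ?nnegrE ?mulr_ge0 ?(ltW B0) ?(ltW D0) ?(le_trans ler01 hr) //.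
  by rewrite ler_peMl // ltW.
- exact: m2.
Qed.

Lemma M0sharp_bounds (K : R) F (h : Rn -> \bar R) : 0 < K ->
  (forall a (l : R), 0 < l ->
    (local_osc s F (cube a l) <= K%:E * ereal_inf [set h y | y in cube a l])%E) ->
  (forall (Q0 : set Rn) x, is_cube Q0 -> Q0 x ->
     (M0sharp_in s Q0 F x <= K%:E * sup_inf_in Q0 h x)%E) /\
  (forall x, (M0sharp s F x <= K%:E * h x)%E).
Proof.
move=> K0 H; split=> [Q0 x _ _|x].
  apply: ge_ereal_sup => _ [Q [[a [l [l0 ->]]] Qx QQ0] <-].
  apply: le_trans (H a l l0) _; apply: lee_wpmul2l; first by rewrite lee_fin ltW.
  by apply: ereal_sup_ubound; exists (cube a l) => //; split => //; exists a, l.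
apply: ge_ereal_sup => _ [Q [[a [l [l0 ->]]] Qx] <-].
apply: le_trans (H a l l0) _; apply: lee_wpmul2l; first by rewrite lee_fin ltW.
by apply: ereal_inf_lbound; exists x.
Qed.

End local_oscillation.

(** * Pointwise bounds for the local sharp maximal functions *)

Theorem theorem4p1 (R : realType) (n : nat) (cn : R)
    (k : 'rV[R]_n.+1 -> 'rV[R]_n.+1 -> R) (omega : R -> R) (r : R)
    (hcn : dim_const n cn)
    (omega_nondecreasing : forall t u : R, 0 < t -> t <= u ->
      omega t <= omega u)
    (hk : kernel_regularity k omega)
    (omega_Dini : (\int[@lebesgue_measure R]_(t in `]0%R, 1%R[)
      (omega (cn * t) / t)%:E < +oo)%E)
    (hr : 1 <= r)
    (T_on_Lr : forall f : 'rV[R]_n.+1 -> R,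
      in_Lr r f -> singular_integral_domain k f)
    (T_weak : weak_type r (singular_integral k))
    (s : R) (hs : 0 < s <= 1 / 2) :
  (exists2 c : R, 0 < c &
    forall f : 'rV[R]_n.+1 -> R, singular_integral_domain k f ->
      (forall (Q0 : set 'rV[R]_n.+1) (x : 'rV[R]_n.+1), is_cube Q0 -> Q0 x ->
         (M0sharp_in s Q0 (singular_integral k f) x <=
            c%:E * sup_inf_in Q0 (Mr r f) x)%E) /\
      (forall x : 'rV[R]_n.+1,
         (M0sharp s (singular_integral k f) x <= c%:E * Mr r f x)%E)) /\
  (annihilates_constants k ->
   (\int[@lebesgue_measure R]_(t in `]0%R, 1%R[)
      (omega (cn * t) * ln t^-1 / t)%:E < +oo)%E ->
   exists2 c : R, 0 < c &
    forall f : 'rV[R]_n.+1 -> R, singular_integral_domain k f ->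
      (forall (Q0 : set 'rV[R]_n.+1) (x : 'rV[R]_n.+1), is_cube Q0 -> Q0 x ->
         (M0sharp_in s Q0 (singular_integral k f) x <=
            c%:E * sup_inf_in Q0 (Msharp r f) x)%E) /\
      (forall x : 'rV[R]_n.+1,
         (M0sharp s (singular_integral k f) x <= c%:E * Msharp r f x)%E)).
Proof.
have s0 : 0 < s by case/andP: hs.
split=> [|T1 Dinilog].
  have [K K0 H] := local_osc_le_Mr hcn omega_nondecreasing hk hr T_on_Lr T_weak s0 omega_Dini.
  by exists K => // f fdom; apply: M0sharp_bounds => // a l l0; exact: H.
have [K K0 H] := local_osc_le_Msharp hcn omega_nondecreasing hk hr T_on_Lr T_weak s0
  omega_Dini T1 Dinilog.
by exists K => // f fdom; apply: M0sharp_bounds => // a l l0; exact: H.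
Qed.
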